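(* Fix $\epsilon\in(0,1)$, and let $\beta=\beta(n)>-1$ be a sequence of real numbers and $N=N(n)>n$ a sequence of natural numbers. Then $$\lim_{n\to\infty}\frac{\mathbb{E}\,V_n(P_{N,n}^\beta)}{V_n(B_2^n)}=\begin{cases}0 & \text{if } N\le \exp\left((1-\epsilon)\left(\beta+\frac{n+1}{2}\right)\log n\right)\text{ for all sufficiently large } n,\\ 1 & \text{if } N\ge \exp\left((1+\epsilon)\left(\beta+\frac{n+1}{2}\right)\log n\right)\text{ for all sufficiently large } n.\end{cases}$$
   Context: $B_2^n$ is the closed Euclidean unit ball in $\mathbb{R}^n$ and $V_n$ is $n$-dimensional Lebesgue measure. For $\beta>-1$, $\nu_\beta$ is the beta distribution, i.e. the probability measure on $B_2^n$ with density proportional to $(1-\|x\|^2)^\beta$, $x\in B_2^n$. For $N>n$, $P_{N,n}^\beta=\mathrm{conv}\{X_1,\ldots,X_N\}$, where $X_1,\ldots,X_N$ are independent random points in $\mathbb{R}^n$ with distribution $\nu_\beta$. *)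

(* Defs.v *)
From HB Require Import structures.
From mathcomp Require Import all_boot all_order all_algebra.
From mathcomp Require Import all_classical all_reals all_analysis.

Set Implicit Arguments.
Unset Strict Implicit.
Unset Printing Implicit Defensive.

Import Order.TTheory GRing.Theory Num.Theory.
Import numFieldNormedType.Exports.

Local Open Scope classical_set_scope.
Local Open Scope ring_scope.

(* R^n is n.-tuple R, whose measurable structure in the library is the product
   sigma-algebra of the Borel sigma-algebra of R, that is, the Borel
   sigma-algebra of R^n. *)

Section volume_step.
Context {R : realType} (n : nat).

(* measurableTypeR R is R with the sigma-algebra on which lebesgue_measure is
   declared; it is convertible to the default one on R. *)
Definition tcons (p : measurableTypeR R * n.-tuple R) : n.+1.-tuple R :=
  [tuple of p.1 :: p.2].

Lemma measurable_tcons : measurable_fun setT tcons.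
Proof. exact: (@measurable_cons _ _ _ R fst n snd). Qed.

Variable mu : {sigma_finite_measure set (n.-tuple R) -> \bar R}.

Definition volS : set (n.+1.-tuple R) -> \bar R :=
  pushforward (@lebesgue_measure R \x mu)%E tcons.

Let volS0 : volS set0 = 0%E.
Proof. by rewrite /volS /pushforward preimage_set0 measure0. Qed.

Let volS_ge0 A : (0 <= volS A)%E.
Proof. by rewrite /volS /pushforward; exact: measure_ge0. Qed.

Let volS_sigma_additive : semi_sigma_additive volS.
Proof.
move=> F mF tF mUF; rewrite /volS /pushforward preimage_bigcup.
have mtcons A : measurable A -> measurable (tcons @^-1` A).
  by move=> mA; rewrite -[X in measurable X]setTI; exact: measurable_tcons.
apply: measure_semi_sigma_additive.
- by move=> k; exact: mtcons.
- apply/trivIsetP => /= i j _ _ ij; rewrite -preimage_setI.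
  by move/trivIsetP : tF => /(_ _ _ Logic.I Logic.I ij) ->; rewrite preimage_set0.
- by rewrite -preimage_bigcup; exact: mtcons.
Qed.

HB.instance Definition _ :=
  isMeasure.Build _ _ _ volS volS0 volS_ge0 volS_sigma_additive.

Let tuncons (t : n.+1.-tuple R) : measurableTypeR R * n.-tuple R :=
  (thead t, [tuple of behead t]).

Let tunconsK p : tuncons (tcons p) = p.
Proof. by case: p => x t; rewrite /tuncons theadE; congr pair; exact: val_inj. Qed.

Let measurable_tuncons : measurable_fun setT tuncons.
Proof.
apply/measurable_fun_pairP; split; first exact: measurable_tnth.
exact: measurable_behead.
Qed.

Let volS_sigma_finite : sigma_finite setT volS.
Proof.
have /sigma_finiteP[F [FT ndF Foo]] := sigma_finiteT (@lebesgue_measure R).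
have /sigma_finiteP[G [GT ndG Goo]] := sigma_finiteT mu.
exists (fun i => tuncons @^-1` (F i `*` G i)).
  apply/esym; rewrite -preimage_bigcup -subTset => t _ /=.
  have : [set: measurableTypeR R] (tuncons t).1 by [].
  rewrite FT => -[i _ Fi].
  have : [set: n.-tuple R] (tuncons t).2 by [].
  rewrite GT => -[j _ Gj].
  exists (maxn i j) => //; split.
    by move: Fi; exact/subsetPset/ndF/leq_maxl.
  by move: Gj; exact/subsetPset/ndG/leq_maxr.
move=> i; have [mF Fi] := Foo i; have [mG Gi] := Goo i; split.
  by rewrite -[X in measurable X]setTI; apply: measurable_tuncons => //;
    exact: measurableX.
rewrite /volS /pushforward -comp_preimage.
rewrite (_ : tuncons \o tcons = id); last by apply/funext => p; exact: tunconsK.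
by rewrite preimage_id product_measure1E// lte_mul_pinfty// ge0_fin_numE.
Qed.

HB.instance Definition _ :=
  @Measure_isSigmaFinite.Build _ _ _ volS volS_sigma_finite.

End volume_step.

(* n-dimensional Lebesgue measure, as the n-fold product of the one-dimensional
   one; lemma vol_box gives its values on boxes. *)
Fixpoint vol {R : realType} (n : nat) :
    {sigma_finite_measure set (n.-tuple R) -> \bar R} :=
  match n with
  | 0 => \d_[tuple]
  | m.+1 => volS (vol m)
  end.

Lemma vol_box {R : realType} (n : nat) (A : 'I_n -> set R) :
  (forall i, measurable (A i)) ->
  vol n [set t | forall i, A i (tnth t i)] =
  (\prod_(i < n) @lebesgue_measure R (A i))%E.
Proof.
elim: n A => [|n IHn] A mA.
  by rewrite big_ord0 /= diracE mem_set//= => -[].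
rewrite big_ord_recl -(IHn (fun i => A (lift ord0 i)))//= /volS /pushforward.
set B := [set t : n.-tuple R | _].
have mB : measurable B.
  have -> : B = \bigcap_(i in [set: 'I_n])
      ((fun t : n.-tuple R => tnth t i) @^-1` A (lift ord0 i)).
    by apply/seteqP; split=> t Bt i; [move=> _|]; exact: Bt.
  apply: fin_bigcap_measurable => [|i _]; first exact: finite_finset.
  by rewrite -[X in measurable X]setTI; exact: measurable_tnth.
rewrite -product_measure1E//; last exact: (mA ord0).
congr (product_measure1 _ _ _); apply/seteqP; split=> -[x t] /= At.
  split=> [|i]; first exact: (At ord0).
  by have := At (lift ord0 i); rewrite tnthS.
case: At => Ax Bt i; case: (unliftP ord0 i) => [j|] ->; last exact: Ax.
by rewrite tnthS; exact: Bt.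
Qed.

Section beta_polytope.
Context {R : realType}.

Definition enorm {n : nat} (x : n.-tuple R) : R :=
  Num.sqrt (\sum_(i < n) tnth x i ^+ 2).

Definition unit_ball (n : nat) : set (n.-tuple R) := [set x | enorm x <= 1].
Arguments unit_ball n _ : clear implicits.

Definition beta_weight (n : nat) (beta : R) (A : set (n.-tuple R)) : \bar R :=
  (\int[vol n]_(x in unit_ball n `&` A) ((1 - enorm x ^+ 2) `^ beta)%:E)%E.

Definition beta_distribution (n : nat) (beta : R) (A : set (n.-tuple R)) :
  \bar R := (beta_weight beta A / beta_weight beta [set: n.-tuple R])%E.

Definition is_convex {n : nat} (C : set (n.-tuple R)) : Prop :=
  forall (x y : n.-tuple R) (t : R), C x -> C y -> 0 <= t <= 1 ->
    C [tuple (1 - t) * tnth x i + t * tnth y i | i < n].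

Definition convex_hull {n : nat} (A : set (n.-tuple R)) : set (n.-tuple R) :=
  smallest is_convex A.

Section random_points.
Context {d : measure_display} {Omega : measurableType d}
  (P : probability Omega R) {n N : nat}.
Variable X : 'I_N -> {RV P >-> n.-tuple R}.

Definition independent_points : Prop :=
  forall (J : {set 'I_N}) (A : 'I_N -> set (n.-tuple R)),
    (forall i, measurable (A i)) ->
    P [set w | forall i, i \in J -> A i (X i w)] =
    (\prod_(i in J) P (X i @^-1` A i))%E.

Definition beta_distributed (beta : R) : Prop :=
  forall (i : 'I_N) (A : set (n.-tuple R)), measurable A ->
    distribution P (X i) A = beta_distribution beta A.

Definition random_polytope (w : Omega) : set (n.-tuple R) :=
  convex_hull [set X i w | i in [set: 'I_N]].

Definition expected_volume : \bar R :=
  (\int[P]_w vol n (random_polytope w))%E.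

End random_points.
End beta_polytope.
Arguments unit_ball {R} n _.

(* Main.v *)
Require Import Defs.
From mathcomp Require Import all_boot all_order all_algebra.
From mathcomp Require Import all_classical all_reals all_analysis.
From mathcomp Require Import measurable_realfun ring lra.

Set Implicit Arguments.
Unset Strict Implicit.
Unset Printing Implicit Defensive.

Import Order.TTheory GRing.Theory Num.Theory.
Import numFieldNormedType.Exports.

Local Open Scope classical_set_scope.
Local Open Scope ring_scope.

(** Write V for Lebesgue measure on R^n, B for the unit ball, W for the measure
    (1 - |x|^2)^beta dx on B, and kappa = beta + (n + 1) / 2. The expected volume
    is governed by the probability W(H) / W(B) of a cap H = {y in B : <y, u> >= r},
    u a unit vector. With s^2 = 1 - r^2 it equals s^(2 kappa) up to factors of
    the form C^kappa and powers of n, which are harmless: as kappa > (n - 1) / 2,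
    they are absorbed by n^(c eps kappa) for any c > 0. This leaves room for the
    crude estimates below.

    Sparse regime. If x lies in the polytope, then some X_i lies in the half-space
    {y : <y, x> >= |x|^2}, whose distance to the origin is |x|. Integrating over
    x gives E V(P) <= V(r B) + N q V(B), where q bounds the probability of the
    caps at distance r (expected_volume_le). For s^2 = n^-(1 - eps / 2) both r^n
    and N q tend to 0 (ratio_small).

    Dense regime. If a point x of r B is outside the polytope, a separating unit
    vector u satisfies <X_i, u> <= r for all i. Replacing u by a vector of a finite
    net, all N points miss one of finitely many caps at distance r + eta, each of
    probability at least p; the chance of that is at most M (1 - p)^N, M the size
    of the net (expected_volume_ge). For r = 1 - 2 n^-(1 + eps / 2) we have
    r^n -> 1, M is n^O(n) and N p >= n^6 (ratio_big).

    Caps. Only translations and dilations of V are used (vol_aff), through cones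
    around u. A cone C takes the same share of every radial measure, so that
    W(C) / W(B) = V(C /\ B) / V(B) (ge0_cone_integral). The cone generated by a
    cap of height 1 - r is about s wide: near the sphere it is contained in a
    ball of radius s (vol_vcone_le), and it contains a ball around u of radius
    comparable to s (vol_vcone_ge). The first inclusion bounds caps from above
    when beta < 0; when beta >= 0 the substitution y = r u + s z does so directly
    (beta_weight_cap_le_translate). The second one, together with the weight of
    a spherical shell, bounds caps from below (beta_weight_ocap_ge).

    The volume of the polytope is compared with measurable functions of the
    outcome, using that the integral of nonnegative functions and V are monotone
    on all functions and on all sets (ge0_le_integral_arbitrary, le_vol). *)

(** * Volume under translations and dilations *)

(** The integral of a nonnegative function is a supremum over the simple
    functions below it, whence monotonicity without measurability. *)
Lemma ge0_le_integral_arbitrary d (T : measurableType d) (R : realType)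
    (mu : {measure set T -> \bar R}) (f g : T -> \bar R) :
  (forall x, 0 <= f x)%E -> (forall x, f x <= g x)%E ->
  (\int[mu]_x f x <= \int[mu]_x g x)%E.
Proof.
move=> f0 fg.
have g0 x : (0 <= g x)%E by exact: le_trans (fg x).
rewrite !ge0_integralTE//; apply: le_ereal_sup => _ [h hf <-].
by exists h => // x; exact: le_trans (fg x).
Qed.

Section volume.
Context {R : realType}.
Local Notation leb := (@lebesgue_measure R).

(** The product measure integrates the measures of sections, so monotonicity on
    arbitrary sets passes from each dimension to the next. *)
Lemma le_vol n (A B : set (n.-tuple R)) : A `<=` B -> (vol n A <= vol n B)%E.
Proof.
elim: n A B => [|n IHn] A B AB.
  rewrite /= !diracE lee_fin ler_nat; case: (boolP (_ \in A)) => [/set_mem/AB|//].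
  by move/mem_set ->.
rewrite /= /volS /pushforward /product_measure1.
apply: ge0_le_integral_arbitrary => x //=; apply: IHn => t.
by rewrite /xsection /= !inE; exact: AB.
Qed.

Definition aff n (a : n.-tuple R) (c : R) (t : n.-tuple R) : n.-tuple R :=
  [tuple tnth a i + c * tnth t i | i < n].

Lemma measurable_aff n (a : n.-tuple R) (c : R) : measurable_fun setT (aff a c).
Proof.
apply/measurable_fun_tnthP => i.
rewrite [X in measurable_fun _ X](_ : _ = fun t => tnth a i + c * tnth t i).
  apply: measurable_funD => //; apply: measurable_funM => //.
  exact: measurable_tnth.
by apply/funext => t; rewrite /= tnth_mktuple.
Qed.

Lemma measurable_preimage d1 d2 (T1 : measurableType d1) (T2 : measurableType d2)
  (f : T1 -> T2) A : measurable_fun setT f -> measurable A -> measurable (f @^-1` A).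
Proof. by move=> mf mA; rewrite -[X in measurable X]setTI; exact: mf. Qed.

Definition line (a c : R) (x : measurableTypeR R) : measurableTypeR R := a + c * x.

Lemma measurable_line a c : measurable_fun setT (line a c).
Proof.
rewrite /line; apply: measurable_funD => //; exact: measurable_funM.
Qed.

Lemma lebesgue_measure_line (a c : R) (A : set (measurableTypeR R)) : 0 < c ->
  measurable A -> (c%:E * leb (line a c @^-1` A) = leb A)%E.
Proof.
move=> c0 mA; have ml := @measurable_line a c.
rewrite -[LHS]/(pushforward (mscale (NngNum (ltW c0)) leb) (line a c) A).
apply/esym/lebesgue_measure_unique => //= _ [[x y]] _ <-.
rewrite /pushforward /mscale/=.
have -> : line a c @^-1` `]x, y] = `](x - a) / c, (y - a) / c]%classic.
  apply/seteqP; split=> z /=; rewrite !in_itv/= /line ltr_pdivrMr// ler_pdivlMr//;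
    by rewrite ltrBlDr lerBrDr [z * c]mulrC ![c * z + a]addrC.
rewrite !lebesgue_measure_itv/= !lte_fin ltr_pM2r ?invr_gt0//.
rewrite ltrD2r; case: ifP => _; last by rewrite mule0.
rewrite -!EFinB -EFinM; congr EFin; field; exact: lt0r_neq0.
Qed.

(** Change of variable in dimension one; it drives the induction in vol_aff. *)
Lemma ge0_integral_line (a c : R) (f : measurableTypeR R -> \bar R) : 0 < c ->
  measurable_fun setT f -> (forall x, 0 <= f x)%E ->
  (c%:E * \int[leb]_x f (line a c x) = \int[leb]_x f x)%E.
Proof.
move=> c0 mf f0.
have mfl := measurableT_comp mf (@measurable_line a c).
rewrite -(@ge0_integral_mscale _ _ _ leb setT measurableT (NngNum (ltW c0)))//.
rewrite -[X in integral _ X](preimage_setT (line a c)).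
rewrite -(@ge0_integral_pushforward _ _ _ _ _ _ (@measurable_line a c)
  (mscale (NngNum (ltW c0)) leb) setT f)//.
apply: eq_measure_integral => [|ml A mA _]; first exact: measurable_line.
by rewrite -[RHS](lebesgue_measure_line a c0 mA).
Qed.

End volume.

Section affine.
Context {R : realType}.
Local Notation leb := (@lebesgue_measure R).

Lemma aff_tcons n (a : n.+1.-tuple R) (c : R) (p : measurableTypeR R * n.-tuple R) :
  aff a c (tcons p) = tcons (thead a + c * p.1, aff [tuple of behead a] c p.2).
Proof.
apply: eq_from_tnth => i; rewrite tnth_mktuple /tcons /=.
case: (unliftP ord0 i) => [j|] ->.
  rewrite /tcons !tnthS tnth_mktuple tnth_behead.
  by congr (tnth a _ + _); apply: val_inj; rewrite /= inordK// ltnS.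
by rewrite /tcons /=.
Qed.

(** The section at x of the preimage is the preimage of the section at
    a_0 + c x: the inner dilation is handled by induction, the outer integral by
    the one-dimensional change of variable. *)
Lemma vol_aff n (a : n.-tuple R) (c : R) (A : set (n.-tuple R)) : 0 < c ->
  measurable A -> ((c ^+ n)%:E * vol n (aff a c @^-1` A) = vol n A)%E.
Proof.
move=> c0; elim: n a A => [|n IHn] a A mA.
  rewrite expr0 mul1e; congr (vol 0 _); apply/seteqP.
  by split => t; rewrite /= (tuple0 (aff a c t)) (tuple0 t).
pose B := @tcons R n @^-1` A.
have mB : measurable B by apply: measurable_preimage mA; exact: measurable_tcons.
rewrite /= /volS /pushforward /product_measure1 -/B.
have mfB : measurable_fun setT (vol n \o xsection B).
  exact: measurable_fun_xsection.
rewrite -(ge0_integral_line (thead a) c0 mfB)//.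
rewrite exprS EFinM -muleA -ge0_integralZl//; last 2 first.
- apply: measurable_fun_xsection; apply: measurable_preimage.
    exact: measurable_tcons.
  by apply: measurable_preimage mA; exact: measurable_aff.
- by rewrite lee_fin ltW// exprn_gt0.
congr (_ * _)%E; apply: eq_integral => x _ /=.
rewrite -[RHS](IHn [tuple of behead a])//; last exact: measurable_xsection.
congr (_ * vol n _)%E; apply/seteqP; split => t;
by rewrite /xsection /= !inE /= -/(tcons (x, t)) aff_tcons.
Qed.

End affine.

Section euclid.
Context {R : realType}.

Lemma ge0_integral_aff n (a : n.-tuple R) (c : R) (f : n.-tuple R -> \bar R) :
  0 < c -> measurable_fun setT f -> (forall x, 0 <= f x)%E ->
  ((c ^+ n)%:E * \int[vol n]_x f (aff a c x) = \int[vol n]_x f x)%E.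
Proof.
move=> c0 mf f0; have cn0 : 0 <= c ^+ n by rewrite exprn_ge0// ltW.
have ma := measurable_aff a c.
have mfl := measurableT_comp mf ma.
rewrite -(@ge0_integral_mscale _ _ _ (vol n) setT measurableT (NngNum cn0))//.
rewrite -[X in integral _ X](preimage_setT (aff a c)).
rewrite -(@ge0_integral_pushforward _ _ _ _ _ _ ma
  (mscale (NngNum cn0) (vol n)) setT f)//.
by apply: eq_measure_integral => A mA _; rewrite -[RHS](vol_aff a c0 mA).
Qed.

(** * Euclidean geometry and cones *)

Definition dot n (x y : n.-tuple R) : R := \sum_(i < n) tnth x i * tnth y i.

Definition zerov n : n.-tuple R := [tuple 0 | i < n].

Lemma dotC n (x y : n.-tuple R) : dot x y = dot y x.
Proof. by apply: eq_bigr => i _; rewrite mulrC. Qed.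

Lemma dot_affl n (a t y : n.-tuple R) c : dot (aff a c t) y = dot a y + c * dot t y.
Proof.
rewrite /dot mulr_sumr -big_split; apply: eq_bigr => i _ /=.
by rewrite tnth_mktuple mulrDl mulrA.
Qed.

Lemma dot_affr n (a t y : n.-tuple R) c : dot y (aff a c t) = dot y a + c * dot y t.
Proof. by rewrite dotC dot_affl !(dotC y). Qed.

Lemma dot0v n (y : n.-tuple R) : dot (zerov n) y = 0.
Proof. by rewrite /dot big1// => i _; rewrite tnth_mktuple mul0r. Qed.

Lemma dotv0 n (y : n.-tuple R) : dot y (zerov n) = 0.
Proof. by rewrite dotC dot0v. Qed.

Lemma dotvv_ge0 n (x : n.-tuple R) : 0 <= dot x x.
Proof. by apply: sumr_ge0 => i _; rewrite -expr2 sqr_ge0. Qed.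

Lemma enorm_ge0 n (x : n.-tuple R) : 0 <= enorm x.
Proof. exact: sqrtr_ge0. Qed.

Lemma sqr_enorm n (x : n.-tuple R) : enorm x ^+ 2 = dot x x.
Proof.
rewrite sqr_sqrtr; first by apply: eq_bigr => i _; rewrite expr2.
by apply: sumr_ge0 => i _; exact: sqr_ge0.
Qed.

Lemma enorm_le n (x : n.-tuple R) c : 0 <= c -> (enorm x <= c) = (dot x x <= c ^+ 2).
Proof. by move=> c0; rewrite -sqr_enorm ler_sqr// nnegrE// enorm_ge0. Qed.

Let mulr_self_ge0 (a : R) : 0 <= a * a.
Proof. by rewrite -expr2 sqr_ge0. Qed.

Lemma enorm_eq0_dot n (x y : n.-tuple R) : enorm x = 0 -> dot x y = 0.
Proof.
move=> x0; rewrite /dot big1// => i _.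
have : dot x x = 0 by rewrite -sqr_enorm x0 expr0n.
move/psumr_eq0P => h; have /eqP := h (fun j _ => mulr_self_ge0 _) i isT.
by rewrite mulf_eq0 orbb => /eqP->; rewrite mul0r.
Qed.

(** Cauchy-Schwarz, from the square of |y| x - |x| y. *)
Lemma dot_le n (x y : n.-tuple R) : dot x y <= enorm x * enorm y.
Proof.
have [x0|x0] := eqVneq (enorm x) 0; first by rewrite x0 mul0r enorm_eq0_dot.
have [y0|y0] := eqVneq (enorm y) 0; first by rewrite y0 mulr0 dotC enorm_eq0_dot.
have xp : 0 < enorm x by rewrite lt_def x0 enorm_ge0.
have yp : 0 < enorm y by rewrite lt_def y0 enorm_ge0.
have := dotvv_ge0 (aff (aff (zerov n) (enorm y) x) (- enorm x) y).
rewrite !(dot_affl, dot_affr) !(dot0v, dotv0) !add0r (dotC y x) -!sqr_enorm.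
set a := enorm x; set b := enorm y; set d := dot x y => h.
have : 0 <= 2 * (a * b) * (a * b - d).
  by apply: le_trans h _; rewrite le_eqVlt; apply/orP; left; apply/eqP; ring.
by rewrite pmulr_rge0 ?subr_ge0// !mulr_gt0.
Qed.

Lemma enorm_scale n (x : n.-tuple R) c : 0 <= c -> enorm (aff (zerov n) c x) = c * enorm x.
Proof.
move=> c0; apply/eqP; rewrite -(@eqrXn2 _ 2)// ?enorm_ge0 ?mulr_ge0 ?enorm_ge0//; apply/eqP.
rewrite exprMn !sqr_enorm !(dot_affl, dot_affr) !(dot0v, dotv0) !add0r.
by rewrite mulr0 add0r expr2 mulrA.
Qed.

Lemma measurable_fun_dot d (T : measurableType d) n (f g : T -> n.-tuple R) :
  measurable_fun setT f -> measurable_fun setT g ->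
  measurable_fun setT (fun w => dot (f w) (g w)).
Proof.
move=> mf mg; apply: measurable_sum => i.
by apply: measurable_funM;
  apply: (@measurableT_comp _ _ _ _ _ _ (fun t : n.-tuple R => tnth t i)) => //;
  exact: measurable_tnth.
Qed.

Lemma measurable_fun_enorm d (T : measurableType d) n (f : T -> n.-tuple R) :
  measurable_fun setT f -> measurable_fun setT (fun w => enorm (f w)).
Proof.
move=> mf.
rewrite [X in measurable_fun _ X](_ : _ = fun w => Num.sqrt (dot (f w) (f w))).
  apply: (@measurableT_comp _ _ _ _ _ _ (@Num.sqrt R)); last exact: measurable_fun_dot.
  apply: continuous_measurable_fun; exact: sqrt_continuous.
by apply/funext => w; rewrite /enorm /dot; congr Num.sqrt.
Qed.

Lemma measurable_set_lt d (T : measurableType d) (f g : T -> R) :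
  measurable_fun setT f -> measurable_fun setT g ->
  measurable [set w | f w < g w].
Proof.
move=> mf mg; rewrite -[X in measurable X]setTI.
exact: (@measurable_fun_ltr _ T R setT f g mf mg measurableT [set true]).
Qed.

Lemma measurable_set_le d (T : measurableType d) (f g : T -> R) :
  measurable_fun setT f -> measurable_fun setT g ->
  measurable [set w | f w <= g w].
Proof.
move=> mf mg; rewrite -[X in measurable X]setTI.
exact: (@measurable_fun_ler _ T R setT f g mf mg measurableT [set true]).
Qed.

Definition cball n (r : R) : set (n.-tuple R) := [set x | enorm x <= r].

Lemma measurable_cball n r : measurable (@cball n r).
Proof. by apply: measurable_set_le => //; exact: measurable_fun_enorm. Qed.

Definition conic n (C : set (n.-tuple R)) :=
  forall c x, 0 < c -> C (aff (zerov n) c x) <-> C x.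

(** The dilation by t maps the part of a cone in the unit ball onto its part in
    the ball of radius t. *)
Lemma vol_cone_cball n (C : set (n.-tuple R)) t : conic C -> measurable C -> 0 < t ->
  vol n (C `&` cball t) = ((t ^+ n)%:E * vol n (C `&` cball 1))%E.
Proof.
move=> cC mC t0; rewrite -(vol_aff (zerov n) t0); last first.
  by apply: measurableI => //; exact: measurable_cball.
congr (_ * vol n _)%E; apply/seteqP; split=> x; rewrite /cball /= enorm_scale ?(ltW t0)//;
by rewrite cC// ger_pMr.
Qed.

Lemma coord_le_enorm n (x : n.-tuple R) i : `|tnth x i| <= enorm x.
Proof.
rewrite -ler_sqr ?nnegrE ?enorm_ge0// real_normK ?num_real// sqr_enorm /dot.
by rewrite (bigD1 i)//= -expr2 lerDl sumr_ge0// => j _; rewrite -expr2 sqr_ge0.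
Qed.

Lemma vol_cball_fin n r : (vol n (@cball n r) < +oo)%E.
Proof.
apply: (@le_lt_trans _ _ (vol n [set t | forall i, `[- r, r]%classic (tnth t i)])).
  apply: le_vol => x xr i /=; rewrite in_itv/= -ler_norml.
  exact: le_trans (coord_le_enorm x i) xr.
rewrite (@vol_box R n (fun=> `[- r, r]%classic))//.
rewrite ltey_eq; apply/orP; left.
elim/big_ind : _ => // [|i _]; first exact: fin_numM.
by rewrite lebesgue_measure_itv; case: ifP.
Qed.

Lemma vol_setI_cball_fin n (A : set (n.-tuple R)) r :
  vol n (A `&` cball r) \is a fin_num.
Proof.
rewrite ge0_fin_numE//; apply: (@le_lt_trans _ _ (vol n (@cball n r))).
  by apply: le_vol => x [].
exact: vol_cball_fin.
Qed.

Lemma vol_cball1_fin n : vol n (@cball n 1) \is a fin_num.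
Proof. by rewrite ge0_fin_numE// vol_cball_fin. Qed.

Lemma vol_cball1_gt0 n : (0 < vol n (@cball n 1))%E.
Proof.
pose r : R := n.+1%:R^-1; have r0 : 0 < r by rewrite invr_gt0.
apply: (@lt_le_trans _ _ (vol n [set t | forall i, `[- r, r]%classic (tnth t i)])).
  rewrite (@vol_box R n (fun=> `[- r, r]%classic))//.
  elim/big_ind : _ => // [|i _]; first exact: mule_gt0.
  by rewrite lebesgue_measure_itv /= lte_fin gtrN// opprK -EFinD lte_fin addr_gt0.
apply: le_vol => x xr; rewrite /cball /= enorm_le//.
apply: (@le_trans _ _ (\sum_(i < n) r ^+ 2)).
  apply: ler_sum => i _; rewrite -expr2 -real_normK ?num_real//.
  rewrite ler_sqr ?nnegrE ?normr_ge0 ?(ltW r0)//.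
  by have := xr i; rewrite /= in_itv/= -ler_norml.
rewrite sumr_const card_ord -mulr_natl /r expr1n exprVn ler_pdivrMr ?exprn_gt0// mul1r.
rewrite -natrX ler_nat; apply: leq_trans (leqnSn n) _.
by rewrite -[X in (X <= _)%N]muln1 leq_mul.
Qed.

End euclid.

Section radial.
Context {R : realType}.

(** For t = 0 the set is invariant under the dilation by 2, hence its finite
    volume vanishes as soon as n > 0. *)
Lemma vol_cone_cball_ge0 n (C : set (n.-tuple R)) t : conic C -> measurable C -> 0 <= t ->
  vol n (C `&` cball t) = ((t ^+ n)%:E * vol n (C `&` cball 1))%E.
Proof.
move=> cC mC; rewrite le_eqVlt => /orP[/eqP<-|]; last exact: vol_cone_cball.
case: n => [|n] in C cC mC *.
  rewrite expr0 mul1e; congr (vol 0 (C `&` _)); apply/seteqP.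
  by split=> x _; rewrite /cball /= enorm_le// /dot big_ord0 // sqr_ge0.
have mC0 : measurable (C `&` cball 0) by apply: measurableI => //; exact: measurable_cball.
have := vol_aff (zerov _) (ltr0Sn R 1) mC0.
set v := vol n.+1 (C `&` cball 0).
have -> : aff (zerov n.+1) 2 @^-1` (C `&` cball 0) = C `&` cball 0.
  apply/seteqP; split=> x; rewrite /cball /= cC// enorm_scale//;
  by rewrite pmulr_rle0.
rewrite -/v expr0n mul0e => /=.
have : v \is a fin_num by exact: vol_setI_cball_fin.
case: v => // r _ [] h; congr EFin; apply/eqP; apply: contraT => r0.
have /eqP := mulIf r0 (etrans h (esym (mul1r r))).
by rewrite pexpr_eq1// => /eqP; lra.
Qed.

(** The norm on E and a value outside ]-oo, 1] elsewhere: preimages of subsets of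
    ]-oo, 1] only see E, which turns restriction to E into a restriction on R. *)
Let gate n (E : set (n.-tuple R)) (x : n.-tuple R) : R := if x \in E then enorm x else 2.

Let measurable_gate n (E : set (n.-tuple R)) : measurable E -> measurable_fun setT (gate E).
Proof.
move=> mE; apply: measurable_fun_ifT => //; last exact: measurable_fun_enorm.
apply: (measurable_fun_bool true); rewrite setTI [X in measurable X](_ : _ = E)//.
by apply/seteqP; split=> x /=; [exact: set_mem|exact: mem_set].
Qed.

Let gate_preimage n (E : set (n.-tuple R)) (A : set R) : E `<=` cball 1 ->
  gate E @^-1` (A `&` `]-oo, 1]) = E `&` [set x | A (enorm x)].
Proof.
move=> E1; apply/seteqP; split => x; rewrite /gate /= in_itv/=.
  case: ifPn => [/set_mem Ex [Ax _]//|_ [_]]; lra.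
by move=> [Ex Ax]; rewrite mem_set//; split=> //; exact: E1.
Qed.

Let pushforward_measure d1 d2 (T1 : measurableType d1) (T2 : measurableType d2)
    (mu : {measure set T1 -> \bar R}) (f : T1 -> T2) : measurable_fun setT f ->
  exists m : {measure set T2 -> \bar R}, forall A, m A = mu (f @^-1` A).
Proof.
move=> mf.
by unshelve refine (ex_intro _ (pushforward mu f : {measure set T2 -> \bar R}) _).
Qed.

Let trace_measure n (E : set (n.-tuple R)) (k : {nonneg R}) : measurable E ->
  E `<=` cball 1 ->
  exists m : {measure set (measurableTypeR R) -> \bar R}, forall A,
    m A = (k%:num%:E * vol n (E `&` [set x | A (enorm x)]))%E.
Proof.
move=> mE E1; pose mg := measurable_gate mE.
have mD : measurable (`]-oo, 1]%classic : set (measurableTypeR R)) by exact: measurable_itv.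
have [m1 m1E] := @pushforward_measure _ _ _ (measurableTypeR R) (mscale k (vol n)) _ mg.
by exists (mrestr m1 mD) => A; rewrite /mrestr /= /mrestr m1E /mscale/= gate_preimage.
Qed.

Let rays : set (set (measurableTypeR R)) :=
  [set A | exists x : R, A = `]-oo, x]%classic].

Let measurable_raysE : @measurable _ (measurableTypeR R) = <<s rays>>.
Proof.
rewrite eqEsubset; split => A.
  rewrite [X in X A -> _](RGenOInfty.measurableE R).
  apply: smallest_sub; first exact: smallest_sigma_algebra.
  move=> _ [x ->]; rewrite -setCitvl -setTD.
  have [_ h _] := smallest_sigma_algebra setT rays.
  by apply: h; apply: sub_sigma_algebra; exists x.
apply: smallest_sub; first exact: sigma_algebra_measurable.
by move=> _ [x ->]; exact: measurable_itv.
Qed.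

Lemma measure_unique_rays (m1 m2 : {measure set (measurableTypeR R) -> \bar R}) :
  (forall t : R, m1 `]-oo, t] = m2 `]-oo, t])%classic ->
  (forall t : R, m1 `]-oo, t]%classic < +oo)%E ->
  forall A, measurable A -> m1 A = m2 A.
Proof.
move=> h hoo.
apply: (@measure_unique _ R _ rays (fun k => `]-oo, k%:R]%classic)).
- exact: measurable_raysE.
- move=> _ _ [x ->] [y ->]; exists (Num.min x y).
  by apply/seteqP; split => z /=; rewrite !in_itv/= le_min => /andP.
- by move=> k; exists k%:R.
- rewrite -subTset => x _; exists (Num.trunc `|x|).+1 => //=.
  by rewrite in_itv/= (le_trans (ler_norm x))// ltW// truncnS_gt.
- by move=> _ [x ->].
- by move=> k; exact: hoo.
Qed.

(** The images under the norm of V on the cone and of V on the ball have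
    distribution functions t^n V(C /\ B) and t^n V(B), so they are proportional,
    and so are the integrals of any radial function. *)
Lemma ge0_cone_integral n (C : set (n.-tuple R)) (g : R -> \bar R) :
  conic C -> measurable C -> measurable_fun setT g -> (forall r, 0 <= g r)%E ->
  (vol n (cball 1) * \int[vol n]_(x in C `&` cball 1) g (enorm x) =
   vol n (C `&` cball 1) * \int[vol n]_(x in cball 1) g (enorm x))%E.
Proof.
move=> cC mC mg g0.
have mb := @measurable_cball R n 1.
have mCB : measurable (C `&` cball 1) by exact: measurableI.
pose v : R := fine (vol n (cball 1)); pose w : R := fine (vol n (C `&` cball 1)).
have v0 : 0 <= v by rewrite fine_ge0.
have w0 : 0 <= w by rewrite fine_ge0.
have vE : vol n (@cball R n 1) = v%:E by rewrite fineK// vol_cball1_fin.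
have wE : vol n (C `&` cball 1) = w%:E by rewrite fineK// vol_setI_cball_fin.
have polar E (k : {nonneg R}) : measurable E -> E `<=` cball 1 ->
    (k%:num%:E * \int[vol n]_(x in E) g (enorm x) =
     \int[pushforward (mscale k (vol n)) (gate E)]_(r in `]-oo, 1%R]) g r)%E.
  move=> mE E1; have mge := measurable_gate mE.
  rewrite (@ge0_integral_pushforward _ _ _ _ _ _ mge)//; last first.
    exact: measurable_funTS.
  have -> : gate E @^-1` `]-oo, 1] = E.
    rewrite -[X in _ @^-1` X]setTI gate_preimage// -[RHS]setIT.
    by congr setI; apply/seteqP.
  rewrite -ge0_integral_mscale//; last first.
    by apply: measurable_funTS; apply: measurableT_comp mg _; exact: measurable_fun_enorm.
  by apply: eq_integral => x xE; rewrite /gate /= xE.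
have b1 : cball 1 `<=` @cball R n 1 by [].
have C1 : C `&` cball 1 `<=` @cball R n 1 by move=> x [].
rewrite vE wE (polar _ (NngNum v0))// (polar _ (NngNum w0))//.
have [m1 m1E] := trace_measure (NngNum v0) mCB C1.
have [m2 m2E] := trace_measure (NngNum w0) mb b1.
apply: eq_measure_integral; [exact: measurable_gate|exact: measurable_gate|].
move=> mgB mgC A mA A1.
have AI : A `&` `]-oo, 1]%classic = A by exact: setIidl.
have gC := gate_preimage A C1; have gB := gate_preimage A b1; rewrite AI in gC gB.
transitivity (m1 A).
  by rewrite m1E -gC.
transitivity (m2 A); last first.
  by rewrite m2E -gB.
apply: measure_unique_rays => // t; last first.
  rewrite m1E /=; apply: lte_mul_pinfty => //.
  apply: (@le_lt_trans _ _ (vol n (@cball R n 1))); last exact: vol_cball_fin.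
  by apply: le_vol => x [[]].
rewrite m1E m2E /=; have [t0|t0] := ltP t 0.
  rewrite (_ : [set x | _] = set0) ?setI0 ?measure0 ?mule0//.
  by apply/seteqP; split=> x //=; rewrite in_itv/=; have := enorm_ge0 x; lra.
pose s := Num.min t 1.
have s0 : 0 <= s by rewrite /s le_min t0 ler01.
have ballE : cball 1 `&` [set x : n.-tuple R | `]-oo, t]%classic (enorm x)] = cball s.
  apply/seteqP; split=> x /=; rewrite in_itv /cball /= /s le_min.
    by move=> [-> ->].
  by move=> /andP[].
have cT : conic [set: n.-tuple R] by [].
have := vol_cone_cball_ge0 cT (@measurableT _ _) s0.
rewrite !setTI -setIA ballE => ->; rewrite vol_cone_cball_ge0// vE wE -!EFinM.
by congr EFin; ring.
Qed.

End radial.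

(** * Upper bound for the weight of a cap *)

Section caps.
Context {R : realType}.
Implicit Types (beta r s t tau : R).

Definition weight beta (t : R) : R := (1 - t ^+ 2) `^ beta.

Lemma weight_ge0 beta t : 0 <= weight beta t.
Proof. exact: powR_ge0. Qed.

Lemma measurable_weight beta : measurable_fun setT (weight beta).
Proof.
rewrite /weight; apply: (@measurableT_comp _ _ _ _ _ _ (fun x : R => x `^ beta)).
  exact: measurable_powR.
by apply: measurable_funB => //; exact: measurable_funX.
Qed.

Lemma measurable_weight_enorm n beta (D : set (n.-tuple R)) :
  measurable_fun D (fun x => (weight beta (enorm x))%:E).
Proof.
apply: measurable_funTS; apply/measurable_EFinP.
apply: (@measurableT_comp _ _ _ _ _ _ (weight beta)); first exact: measurable_weight.
exact: measurable_fun_enorm.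
Qed.

Lemma beta_weightE n beta (A : set (n.-tuple R)) : beta_weight beta A =
  (\int[vol n]_(x in A `&` cball 1) (weight beta (enorm x))%:E)%E.
Proof. by rewrite setIC. Qed.

Lemma le_beta_weight n beta (A D : set (n.-tuple R)) : measurable A -> measurable D ->
  A `&` cball 1 `<=` D -> (beta_weight beta A <= beta_weight beta D)%E.
Proof.
move=> mA mD AD; rewrite !beta_weightE.
have mB := @measurable_cball R n 1.
apply: ge0_subset_integral.
- exact: measurableI.
- exact: measurableI.
- exact: measurable_weight_enorm.
- by move=> x _; rewrite lee_fin weight_ge0.
- by move=> x [Ax Bx]; split => //; exact: AD.
Qed.

(** The directional and the radial parts of the beta weight are independent. *)
Lemma beta_weight_cone n beta (C : set (n.-tuple R)) (S : set R) :
  conic C -> measurable C -> measurable S ->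
  (vol n (cball 1) * beta_weight beta (C `&` [set x | S (enorm x)]) =
   vol n (C `&` cball 1) * beta_weight beta [set x : n.-tuple R | S (enorm x)])%E.
Proof.
move=> cC mC mS; rewrite !beta_weightE.
pose g := (EFin \o weight beta) \_ S.
have mg : measurable_fun setT g.
  have mw : measurable_fun S (EFin \o weight beta).
    by apply: measurable_funTS; apply/measurable_EFinP; exact: measurable_weight.
  exact: (measurable_restrictT _ mS).1 mw.
have g0 r : (0 <= g r)%E by apply: erestrict_ge0 => x _; rewrite lee_fin weight_ge0.
have eqg D :
    (\int[vol n]_(x in D `&` [set x | S (enorm x)] `&` cball 1) (weight beta (enorm x))%:E =
    \int[vol n]_(x in D `&` cball 1) g (enorm x))%E.
  rewrite setIAC integral_mkcondr; apply: eq_integral => x xD.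
  rewrite /g !patchE; congr (if _ then _ else _).
rewrite eqg -[[set x | S (enorm x)] in RHS]setTI eqg setTI.
exact: ge0_cone_integral.
Qed.

Definition vcone n (u : n.-tuple R) r : set (n.-tuple R) :=
  [set y | r * enorm y <= dot y u].

Lemma measurable_vcone n (u : n.-tuple R) r : measurable (vcone u r).
Proof.
apply: measurable_set_le; last exact: measurable_fun_dot.
by apply: measurable_funM => //; exact: measurable_fun_enorm.
Qed.

Lemma conic_vcone n (u : n.-tuple R) r : conic (vcone u r).
Proof.
move=> c x c0; rewrite /vcone /= enorm_scale ?(ltW c0)// dot_affl dot0v add0r.
by rewrite mulrCA ler_pM2l.
Qed.

Lemma vol_shell n (C : set (n.-tuple R)) a b : conic C -> measurable C -> 0 <= b <= a ->
  vol n (C `&` cball a `\` cball b) = ((a ^+ n - b ^+ n)%:E * vol n (C `&` cball 1))%E.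
Proof.
move=> cC mC /andP[b0 ba]; have mB t := @measurable_cball R n t.
have fin t : vol n (C `&` cball t) \is a fin_num by exact: vol_setI_cball_fin.
have mCB t : measurable (C `&` cball t) by exact: measurableI.
have -> : C `&` cball a `\` cball b = (C `&` cball a) `\` (C `&` cball b).
  by apply/seteqP; split=> x; rewrite /cball /=; tauto.
have ab : C `&` cball b `<=` C `&` cball a.
  by move=> x; rewrite /cball /= => -[? xb]; split=> //; exact: le_trans ba.
have -> : vol n ((C `&` cball a) `\` (C `&` cball b)) =
    (vol n (C `&` cball a) - vol n (C `&` cball b))%E.
  rewrite measureD//; last by rewrite -ge0_fin_numE ?fin.
  by congr (_ - vol n _)%E; apply/setIidPr.
rewrite (vol_cone_cball_ge0 cC mC b0) (vol_cone_cball_ge0 cC mC (le_trans b0 ba)).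
by rewrite -muleBl//; exact: fin.
Qed.

(** If 1 - 2 s^2 <= |y| <= 1 and y is in the cone, then |y - r u| <= s. The
    condition on n puts the shell 1 - 1/n <= |y| <= 1 in that range, and this
    shell carries at least half of the volume of the cone in the ball. *)
Lemma vol_vcone_le n (u : n.-tuple R) r s : (0 < n)%N -> enorm u = 1 -> 0 <= r -> 0 < s ->
  r ^+ 2 + s ^+ 2 = 1 -> n%:R^-1 <= 2 * s ^+ 2 ->
  (vol n (vcone u r `&` cball 1) <= (2 * s ^+ n)%:E * vol n (@cball R n 1))%E.
Proof.
move=> n0 u1 r0 s0 rs ns; pose rho : R := 1 - n%:R^-1.
have rho0 : 0 <= rho by rewrite subr_ge0 invf_le1 ?ltr0n// ler1n.
have rho1 : rho <= 1 by rewrite /rho gerBl.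
have rhon : rho ^+ n <= 2^-1.
  have e2 : 2 <= expR 1 :> R by apply: le_trans (expR_ge1Dx 1); lra.
  apply: (@le_trans _ _ (expR (- n%:R^-1) ^+ n)).
    by rewrite lerXn2r ?nnegrE ?expR_ge0//; exact: expR_ge1Dx.
  rewrite -expRM_natl mulrN mulfV ?pnatr_eq0 -?lt0n// expRN lef_pV2 ?posrE//; lra.
set C := vcone u r; have mC : measurable C := measurable_vcone u r.
have cC : conic C := @conic_vcone _ u r.
have mB t := @measurable_cball R n t.
have shell : (vol n (C `&` cball 1 `\` cball rho) <= (s ^+ n)%:E * vol n (@cball R n 1))%E.
  rewrite -(vol_aff (aff (zerov n) r u) s0); last by apply: measurableD => //; exact: measurableI.
  rewrite lee_pmul2l ?lte_fin ?exprn_gt0//; apply: le_vol => z /=.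
  rewrite /C /vcone /cball /=; set y := aff _ s z => -[[hC y1] /negP].
  rewrite -ltNge => yrho.
  have uu : dot u u = 1 by rewrite -sqr_enorm u1 expr1n.
  have yu : dot y u = r + s * dot z u by rewrite /y !dot_affl dot0v uu mulr1 add0r.
  have yy : enorm y ^+ 2 = r ^+ 2 + 2 * r * s * dot z u + s ^+ 2 * dot z z.
    rewrite sqr_enorm /y !(dot_affl, dot_affr) !(dot0v, dotv0) (dotC u z) uu; ring.
  rewrite enorm_le// expr1n -(ler_pM2l (exprn_gt0 2 s0)) mulr1.
  have := enorm_ge0 y; set e := enorm y in hC y1 yrho yy * => e0; rewrite yu in hC.
  (* s^2 |z|^2 = |y - r u|^2 <= |y|^2 - 2 r^2 |y| + r^2, which is at most s^2
     if and only if (1 - |y|) (|y| - 1 + 2 s^2) >= 0. *)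
  have h1 : 2 * r * (r * e) <= 2 * r * (r + s * dot z u) by rewrite ler_wpM2l// mulr_ge0.
  have h2 : (1 - e) * (e - 1 + 2 * s ^+ 2) >= 0.
    by apply: mulr_ge0; rewrite ?subr_ge0//; rewrite /rho in yrho; lra.
  nra.
rewrite vol_shell// ?rho0// expr1n in shell.
have fin : vol n (C `&` cball 1) \is a fin_num by exact: vol_setI_cball_fin.
have finB : vol n (@cball R n 1) \is a fin_num by exact: vol_cball1_fin.
move: shell.
rewrite -(fineK fin) -(fineK finB) -!EFinM !lee_fin => hs.
have h : 0 <= (2^-1 - rho ^+ n) * fine (vol n (C `&` cball 1)).
  apply: mulr_ge0; last exact: fine_ge0.
  by rewrite subr_ge0.
move: hs h; rewrite -mulrA !mulrBl mul1r; lra.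
Qed.

End caps.

Section cap_weights.
Context {R : realType}.
Implicit Types (beta r s t tau : R).

Definition cap n (u : n.-tuple R) r : set (n.-tuple R) := [set y | r <= dot y u].

Lemma measurable_cap n (u : n.-tuple R) r : measurable (cap u r).
Proof. by apply: measurable_set_le => //; exact: measurable_fun_dot. Qed.

Lemma le_weight beta s z w : 0 <= beta -> 0 < s -> 0 <= 1 - z ^+ 2 ->
  1 - z ^+ 2 <= s ^+ 2 * (1 - w ^+ 2) ->
  weight beta z <= (s ^+ 2) `^ beta * weight beta w.
Proof.
move=> b0 s0 z0 zw; have := le_trans z0 zw; rewrite pmulr_rge0 ?exprn_gt0// => w0.
have s2 : 0 < s ^+ 2 by rewrite exprn_gt0.
rewrite /weight -powRM ?(ltW s2)//.
by apply: ge0_ler_powR; rewrite ?nnegrE // mulr_ge0 // ltW.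
Qed.

(** Substitute y = r u + s z. On the cap <z, u> >= 0, whence |z| <= 1 and
    1 - |y|^2 <= s^2 (1 - |z|^2); the power beta preserves this inequality. *)
Lemma beta_weight_cap_le_translate n beta (u : n.-tuple R) r s : 0 <= beta ->
  enorm u = 1 -> 0 <= r -> 0 < s -> r ^+ 2 + s ^+ 2 = 1 ->
  (beta_weight beta (cap u r) <=
   (s ^+ n * (s ^+ 2) `^ beta)%:E * beta_weight beta [set: n.-tuple R])%E.
Proof.
move=> b0 u1 r0 s0 rs; have mB := @measurable_cball R n 1.
have mcap := measurable_cap u r.
rewrite !beta_weightE setTI integral_mkcond.
set f := (X in (\int[_]_x X x)%E).
have f0 x : (0 <= f x)%E by apply: erestrict_ge0 => y _; rewrite lee_fin weight_ge0.
have mf : measurable_fun setT f.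
  apply: (measurable_restrictT _ _).1; first exact: measurableI.
  exact: measurable_weight_enorm.
rewrite -(ge0_integral_aff (aff (zerov n) r u) s0 mf f0) EFinM -muleA.
rewrite lee_pmul2l ?lte_fin ?exprn_gt0//.
rewrite -ge0_integralZl//; last 3 first.
- exact: measurable_weight_enorm.
- by move=> x _; rewrite lee_fin weight_ge0.
- by rewrite lee_fin powR_ge0.
rewrite [leRHS]integral_mkcond.
apply: ge0_le_integral_arbitrary => z //; rewrite /f !patchE.
have uu : dot u u = 1 by rewrite -sqr_enorm u1 expr1n.
set y := aff _ s z.
have yu : dot y u = r + s * dot z u by rewrite /y !dot_affl dot0v uu mulr1 add0r.
have yy : enorm y ^+ 2 = r ^+ 2 + 2 * r * s * dot z u + s ^+ 2 * enorm z ^+ 2.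
  rewrite !sqr_enorm /y !(dot_affl, dot_affr) !(dot0v, dotv0) (dotC u z) uu; ring.
case: ifPn => [/set_mem [capy y1]|_]; last first.
  by case: ifPn => // _; rewrite mule_ge0// lee_fin ?powR_ge0 ?weight_ge0.
have zu : 0 <= 2 * r * s * dot z u.
  rewrite mulr_ge0//; first by rewrite !mulr_ge0// ltW.
  by move: capy; rewrite /cap /= yu lerDl pmulr_rge0.
have y1' : enorm y ^+ 2 <= 1 by rewrite sqr_enorm -(expr1n _ 2) -enorm_le.
rewrite ifT; last first.
  apply/mem_set; rewrite /cball /= enorm_le// expr1n -sqr_enorm.
  by rewrite -(ler_pM2l (exprn_gt0 2 s0)) mulr1; lra.
rewrite -EFinM lee_fin le_weight// ?subr_ge0//; lra.
Qed.

(** Enlarge the cap to a cone: the radial weight, which for beta < 0 blows up at the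
    sphere, then cancels in the quotient by the total weight. *)
Lemma beta_weight_cap_le_cone n beta (u : n.-tuple R) r s : (0 < n)%N ->
  enorm u = 1 -> 0 <= r -> 0 < s -> r ^+ 2 + s ^+ 2 = 1 -> n%:R^-1 <= 2 * s ^+ 2 ->
  (beta_weight beta (cap u r) <=
   (2 * s ^+ n)%:E * beta_weight beta [set: n.-tuple R])%E.
Proof.
move=> n0 u1 r0 s0 rs ns.
have mC := measurable_vcone u r; have cC : conic (vcone u r) := @conic_vcone _ _ u r.
apply: (@le_trans _ _ (beta_weight beta (vcone u r))).
  apply: le_beta_weight => //; first exact: measurable_cap.
  move=> x [/= xu x1]; apply: le_trans xu; rewrite -[leRHS]mulr1.
  by rewrite ler_wpM2l.
have fB : vol n (@cball R n 1) \is a fin_num by exact: vol_cball1_fin.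
rewrite -(@lee_pmul2l _ (fine (vol n (@cball R n 1)))%:E)//; last first.
  by rewrite lte_fin fine_gt0// vol_cball1_gt0 vol_cball_fin.
rewrite fineK//.
have := beta_weight_cone beta cC mC measurableT.
rewrite (_ : [set x | _] = setT) ?setIT; last by apply/seteqP.
move=> ->; rewrite muleA (muleC (vol n _) (_)%:E) lee_wpmul2r//.
  by apply: integral_ge0 => x _; rewrite lee_fin powR_ge0.
exact: vol_vcone_le.
Qed.

Lemma exprn_powR_half n s : 0 <= s -> s ^+ n = (s ^+ 2) `^ (n%:R / 2).
Proof.
move=> s0; rewrite -[in RHS]powR_mulrn// -powRrM mulrC -mulrA mulVf// mulr1.
by rewrite powR_mulrn.
Qed.

(** Each of the two bounds is used for one sign of beta; for beta <= 0 the exponent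
    n / 2 may be lowered to beta + n / 2, since s <= 1. *)
Lemma beta_weight_cap_le n beta (u : n.-tuple R) r s : (0 < n)%N ->
  enorm u = 1 -> 0 <= r -> 0 < s -> r ^+ 2 + s ^+ 2 = 1 -> n%:R^-1 <= 2 * s ^+ 2 ->
  (beta_weight beta (cap u r) <=
   (2 * (s ^+ 2) `^ (beta + n%:R / 2))%:E * beta_weight beta [set: n.-tuple R])%E.
Proof.
move=> n0 u1 r0 s0 rs ns; have s2 : 0 < s ^+ 2 by rewrite exprn_gt0.
have W0 : (0 <= beta_weight beta [set: n.-tuple R])%E.
  by apply: integral_ge0 => x _; rewrite lee_fin powR_ge0.
have [b0|/ltW b0] := leP 0 beta.
  apply: (le_trans (beta_weight_cap_le_translate b0 u1 r0 s0 rs)).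
  rewrite lee_wpmul2r// lee_fin (exprn_powR_half _ (ltW s0)) -powRD; last first.
    by rewrite (gt_eqF s2) implybT.
  by rewrite addrC ler_peMl ?powR_ge0// ler1n.
apply: (le_trans (beta_weight_cap_le_cone beta n0 u1 r0 s0 rs ns)).
rewrite lee_wpmul2r// lee_fin ler_pM2l// (exprn_powR_half _ (ltW s0)).
apply: ger_powR; last by rewrite gerDr.
by rewrite s2 -rs lerDr sqr_ge0.
Qed.

(** The cone contains the ball of radius q / 4 around u, and that ball is contained
    in 2 B: the distance from u to the boundary of the cone is about q. *)
Lemma vol_vcone_ge n (u : n.-tuple R) (q : R) : enorm u = 1 -> 0 < q <= 1 ->
  (((q / 8) ^+ n)%:E * vol n (@cball R n 1) <=
   vol n (vcone u (1 - q ^+ 2 / 2) `&` cball 1))%E.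
Proof.
move=> u1 /andP[q0 q1]; set r := 1 - _; set C := vcone u r.
have mC : measurable C := measurable_vcone u r.
have cC : conic C := @conic_vcone _ _ u r.
have mB t := @measurable_cball R n t.
have q40 : 0 < q / 4 by rewrite divr_gt0.
have q20 : q ^+ 2 <= q by rewrite expr2 ler_piMr// ltW.
have uu : dot u u = 1 by rewrite -sqr_enorm u1 expr1n.
have : ((2 ^+ n)%:E * vol n (C `&` cball 1) >= ((q / 4) ^+ n)%:E * vol n (@cball R n 1))%E.
  rewrite -(vol_cone_cball cC mC (ltr0Sn R 1)).
  rewrite -[leRHS](vol_aff u q40); last exact: measurableI.
  rewrite lee_pmul2l ?lte_fin ?exprn_gt0//; apply: le_vol => z z1.
  rewrite /C /vcone /cball /=; set y := aff _ _ z.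
  have yu : dot y u = 1 + q / 4 * dot z u by rewrite /y !dot_affl uu.
  have yy : enorm y ^+ 2 = 1 + q / 2 * dot z u + (q / 4) ^+ 2 * enorm z ^+ 2.
    rewrite !sqr_enorm /y !(dot_affl, dot_affr) (dotC u z) uu; lra.
  have zz : enorm z ^+ 2 <= 1 by rewrite sqr_enorm -(expr1n _ 2) -enorm_le.
  have zu1 : dot z u <= 1 by apply: le_trans (dot_le z u) _; rewrite u1 mulr1.
  have zu2 : - 1 <= dot z u.
    have := dot_le (aff (zerov n) (-1) z) u; rewrite dot_affl dot0v add0r u1 mulr1.
    have -> : enorm (aff (zerov n) (-1) z) = enorm z.
      rewrite /enorm; congr Num.sqrt; apply: eq_bigr => i _.
      by rewrite !tnth_mktuple add0r mulN1r sqrrN.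
    by move: z1; rewrite /cball /=; lra.
  have r0 : 0 <= r by rewrite /r; lra.
  have qd1 : q * dot z u <= q by rewrite ler_piMr// ltW.
  have qd2 : - q <= q * dot z u by rewrite -[leLHS]mulrN1 ler_wpM2l// ltW.
  have q2z : q ^+ 2 * enorm z ^+ 2 <= q ^+ 2 by rewrite ler_piMr// sqr_ge0.
  have q2z0 : 0 <= q ^+ 2 * enorm z ^+ 2 by rewrite mulr_ge0// sqr_ge0.
  have y12 : 2^-1 <= enorm y ^+ 2 by rewrite yy; lra.
  split; last by rewrite enorm_le// -sqr_enorm yy; lra.
  rewrite -ler_sqr ?nnegrE ?mulr_ge0 ?enorm_ge0//; last by rewrite yu; lra.
  have r2 : r ^+ 2 <= 1 - 3 / 4 * q ^+ 2.
    have : q ^+ 2 * q ^+ 2 <= q ^+ 2 by rewrite ler_piMr ?sqr_ge0//; lra.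
    rewrite /r; lra.
  have qd0 : 0 <= q ^+ 2 * dot z u ^+ 2 by rewrite mulr_ge0// sqr_ge0.
  apply: (@le_trans _ _ ((1 - 3 / 4 * q ^+ 2) * enorm y ^+ 2)).
    by rewrite exprMn ler_wpM2r// sqr_ge0.
  have : q ^+ 2 * 2^-1 <= q ^+ 2 * enorm y ^+ 2 by rewrite ler_wpM2l// sqr_ge0.
  rewrite mulrBl mul1r -mulrA [X in X - _ <= _]yy yu; lra.
have fin : vol n (C `&` cball 1) \is a fin_num by exact: vol_setI_cball_fin.
have finB : vol n (@cball R n 1) \is a fin_num by exact: vol_cball1_fin.
rewrite -(fineK fin) -(fineK finB) -!EFinM !lee_fin => h.
rewrite -(ler_pM2l (exprn_gt0 n (ltr0Sn R 1))); apply: le_trans h.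
rewrite mulrA -exprMn le_eqVlt; apply/orP; left; apply/eqP; congr (_ ^+ _ * _); lra.
Qed.

End cap_weights.

(** * Lower bound for the weight of a cap *)

Section cap_lower.
Context {R : realType}.
Implicit Types (beta r s t tau : R).

Lemma beta_weight_ge_cst n beta k (D : set (n.-tuple R)) : measurable D -> 0 <= k ->
  (forall x, D x -> enorm x <= 1 -> k <= weight beta (enorm x)) ->
  (k%:E * vol n (D `&` cball 1) <= beta_weight beta D)%E.
Proof.
move=> mD k0 kD; rewrite beta_weightE.
have mDB : measurable (D `&` cball 1).
  by apply: measurableI => //; exact: measurable_cball.
rewrite -integral_cst//; apply: ge0_le_integral => //.
- exact: measurable_weight_enorm.
- by move=> x [Dx x1]; rewrite lee_fin kD.
Qed.

Lemma beta_weight_le_cst n beta k (D : set (n.-tuple R)) : measurable D -> 0 <= k ->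
  (forall x, D x -> enorm x <= 1 -> weight beta (enorm x) <= k) ->
  (beta_weight beta D <= k%:E * vol n (D `&` cball 1))%E.
Proof.
move=> mD k0 kD; rewrite beta_weightE.
have mDB : measurable (D `&` cball 1).
  by apply: measurableI => //; exact: measurable_cball.
rewrite -integral_cst//; apply: ge0_le_integral => //.
- by move=> x _; rewrite lee_fin weight_ge0.
- exact: measurable_weight_enorm.
- by move=> x [Dx x1]; rewrite lee_fin kD.
Qed.

Lemma bernoulli_le n (x : R) : 0 <= x <= 1 -> 1 - n%:R * x <= (1 - x) ^+ n.
Proof.
move=> /andP[x0 x1]; elim: n => [|n IHn]; first by rewrite expr0 mul0r subr0.
apply: (@le_trans _ _ ((1 - x) * (1 - n%:R * x))).
  have : 0 <= n%:R * (x * x) by rewrite !mulr_ge0.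
  by rewrite -natr1; lra.
by rewrite exprS ler_wpM2l// subr_ge0.
Qed.

(** This is the share of the volume of a cone taken by the shell
    1 - tau / 2 < |x| <= 1 - tau / 4; it stays away from the sphere, where the
    weight may vanish. *)
Lemma shell_fraction n tau : (0 < n)%N -> 0 < tau <= 1 -> n%:R * tau <= 1 ->
  tau / 8 <= (1 - tau / 4) ^+ n - (1 - tau / 2) ^+ n.
Proof.
move=> n0 /andP[t0 t1] nt; set a := 1 - tau / 4; set b := 1 - tau / 2.
have a12 : 2^-1 <= a ^+ n.
  apply: le_trans (bernoulli_le n (x := tau / 4) _); first by lra.
  by apply/andP; split; lra.
have : b ^+ n <= a ^+ n * (1 - tau / 4).
  apply: (@le_trans _ _ ((a * (1 - tau / 4)) ^+ n)).
    rewrite lerXn2r ?nnegrE ?mulr_ge0/a/b//; try lra.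
    have : 0 <= tau * tau by rewrite mulr_ge0 // ltW.
    by lra.
  rewrite exprMn ler_wpM2l//; first by lra.
  by rewrite ler_iXnr//; lra.
have : tau * 2^-1 <= tau * a ^+ n by rewrite ler_pM2l.
by lra.
Qed.

Lemma weight_nonincr beta t t' : beta <= 0 -> 0 <= t <= t' -> t' < 1 ->
  weight beta t <= weight beta t'.
Proof.
move=> b0 /andP[t0 tt'] t'1.
have h : 0 < 1 - t' ^+ 2 by rewrite subr_gt0 exprn_ilt1// (le_trans t0).
have h2 : 1 - t' ^+ 2 <= 1 - t ^+ 2 by rewrite lerB// lerXn2r ?nnegrE// (le_trans t0).
have [c c0 ->] : exists2 c, 0 <= c & beta = - c.
  by exists (- beta); rewrite ?oppr_ge0 ?opprK.
have h3 := lt_le_trans h h2.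
rewrite /weight !powRN lef_pV2 ?posrE ?powR_gt0//.
by apply: ge0_ler_powR; rewrite ?nnegrE// ltW.
Qed.

Definition ocap n (u : n.-tuple R) r : set (n.-tuple R) := [set y | r < dot y u].

Lemma measurable_ocap n (u : n.-tuple R) r : measurable (ocap u r).
Proof. by apply: measurable_set_lt => //; exact: measurable_fun_dot. Qed.

Variables (n : nat) (u : n.-tuple R) (q : R).
Hypotheses (n_gt0 : (0 < n)%N) (u1 : enorm u = 1) (q01 : 0 < q <= 1).
Local Notation tau := (q ^+ 2).
Hypothesis ntau : n%:R * tau <= 1.
Let a : R := 1 - tau / 4.
Let b : R := 1 - tau / 2.
Let C := vcone u b.
Let q0 : 0 < q. Proof. by case/andP: q01. Qed.
Let tau0 : 0 < tau. Proof. by rewrite exprn_gt0. Qed.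
Let tau1 : tau <= 1. Proof. by case/andP: q01 => ? ?; rewrite exprn_ile1// ltW. Qed.
Let tau01 : 0 < tau <= 1. Proof. by rewrite tau0 tau1. Qed.
Let ba : 0 <= b <= a.
Proof. by have := tau0; have := tau1; rewrite /a /b => ? ?; apply/andP; split; lra. Qed.
Let mC : measurable C. Proof. exact: measurable_vcone. Qed.
Let cC : conic C. Proof. exact: conic_vcone. Qed.
Let mB t : measurable (@cball R n t). Proof. exact: measurable_cball. Qed.
Let finB : vol n (@cball R n 1) \is a fin_num.
Proof. exact: vol_cball1_fin. Qed.

Let cone_shell_sub_cap : C `&` [set x | b < enorm x] `<=` ocap u (1 - tau).
Proof.
move=> x [/= Cx bx]; have t0 := tau0; have t1 := tau1; rewrite /ocap /=; apply: lt_le_trans Cx.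
apply: (@le_lt_trans _ _ (b * b)); first by rewrite /b; have := sqr_ge0 tau; lra.
by rewrite ltr_pM2l// /b; lra.
Qed.

(** On the shell the weight is at least (tau / 4)^beta, and it is at most 1 on B. *)
Let beta_weight_ocap_pos beta : 0 <= beta ->
  (((tau / 4) `^ beta * (tau / 8) * (q / 8) ^+ n)%:E * beta_weight beta [set: n.-tuple R] <=
   beta_weight beta (ocap u (1 - tau)))%E.
Proof.
move=> b0; have t0 := tau0; have t1 := tau1.
have WV : (beta_weight beta [set: n.-tuple R] <= vol n (@cball R n 1))%E.
  rewrite -[leRHS]mul1e -[X in (_ * vol n X)%E]setTI.
  apply: beta_weight_le_cst => // x _ x1; rewrite /weight.
  apply: (@le_trans _ _ (1 `^ beta)); last by rewrite powR1.
  apply: ge0_ler_powR; rewrite ?nnegrE//; last by rewrite gerBl sqr_ge0.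
  by rewrite subr_ge0 exprn_ile1// enorm_ge0.
apply: (@le_trans _ _
    (((tau / 4) `^ beta)%:E * vol n ((C `&` cball a `\` cball b) `&` cball 1))%E); last first.
  have mCab : measurable (C `&` cball a `\` cball b) by apply: measurableD => //; exact: measurableI.
  apply: (@le_trans _ _ (beta_weight beta (C `&` cball a `\` cball b))); last first.
    apply: le_beta_weight => //; first exact: measurable_ocap.
    move=> x [[[Cx xa] /negP xb] _]; apply: cone_shell_sub_cap; split => //=.
    by rewrite ltNge.
  apply: beta_weight_ge_cst => //; first exact: powR_ge0.
  move=> x [[_ xa] xb] x1; rewrite /weight; apply: ge0_ler_powR; rewrite ?nnegrE//.
  - by rewrite divr_ge0// ltW.
  - by rewrite subr_ge0 exprn_ile1// enorm_ge0.
  - have : enorm x ^+ 2 <= a ^+ 2.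
      by rewrite lerXn2r ?nnegrE ?enorm_ge0//; case/andP: ba => /le_trans; exact.
    have : tau * tau <= tau * 1 by rewrite ler_pM2l.
    by rewrite /a; lra.
have -> : (C `&` cball a `\` cball b) `&` cball 1 = C `&` cball a `\` cball b.
  apply/setIidl => x [[_ xa] _]; rewrite /cball /=; apply: (le_trans xa); rewrite /a; lra.
rewrite vol_shell//.
rewrite -mulrA EFinM -muleA lee_pmul2l ?lte_fin ?powR_gt0 ?divr_gt0//.
rewrite EFinM -muleA; apply: lee_pmul.
- by rewrite lee_fin divr_ge0// ltW.
- apply: mule_ge0; first by rewrite lee_fin exprn_ge0// divr_ge0// ltW.
  by apply: integral_ge0 => x _; rewrite lee_fin powR_ge0.
- by rewrite lee_fin shell_fraction.
apply: le_trans (vol_vcone_ge u1 q01).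
by rewrite lee_wpmul2l// lee_fin exprn_ge0// divr_ge0// ltW.
Qed.

(** Inside the open ball the weight increases with the norm, so the region |x| > 1 - tau / 2 has at
    least the share of W, up to a constant, that the shell has of V; the cone takes
    the same share of that region as of B. *)
Let beta_weight_ocap_neg beta : beta <= 0 ->
  (((tau / 9) * (q / 8) ^+ n)%:E * beta_weight beta [set: n.-tuple R] <=
   beta_weight beta (ocap u (1 - tau)))%E.
Proof.
move=> b0; have t0 := tau0; have t1 := tau1; pose S : set R := `]b, +oo[%classic.
have mS : measurable S by exact: measurable_itv.
pose D : set (n.-tuple R) := [set x | S (enorm x)].
have SE x : D x = (b < enorm x) :> Prop by rewrite /D /S /= in_itv/= andbT.
have mD : measurable D.
  rewrite (_ : D = [set x | b < enorm x]); last by apply/funext => x; rewrite SE.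
  by apply: measurable_set_lt => //; exact: measurable_fun_enorm.
have W0 (A : set (n.-tuple R)) : (0 <= beta_weight beta A)%E.
  by apply: integral_ge0 => x _; rewrite lee_fin powR_ge0.
have step1 : (((q / 8) ^+ n)%:E * beta_weight beta D <= beta_weight beta (ocap u (1 - tau)))%E.
  apply: (@le_trans _ _ (beta_weight beta (C `&` D))); last first.
    apply: le_beta_weight; [exact: measurableI|exact: measurable_ocap|].
    move=> x [[Cx Dx] _]; apply: cone_shell_sub_cap; split => //.
    by move: Dx; rewrite SE.
  rewrite -(@lee_pmul2l _ (fine (vol n (@cball R n 1)))%:E)//; last first.
    by rewrite lte_fin fine_gt0// vol_cball1_gt0 vol_cball_fin.
  rewrite fineK// beta_weight_cone// muleA lee_wpmul2r//.
  by rewrite muleC vol_vcone_ge.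
apply: le_trans step1; rewrite mulrC EFinM -muleA lee_pmul2l//; last first.
  by rewrite lte_fin exprn_gt0// divr_gt0.
pose g0 := weight beta b.
have g00 : 0 <= g0 by exact: weight_ge0.
have WD : ((g0 * (tau / 8))%:E * vol n (@cball R n 1) <= beta_weight beta D)%E.
  apply: (@le_trans _ _ (beta_weight beta (cball a `\` cball b))); last first.
    apply: le_beta_weight => //; first exact: measurableD.
    by move=> x [[_ /negP]]; rewrite -ltNge SE.
  apply: le_trans (beta_weight_ge_cst (k := g0) _ _ _) => //; last 2 first.
  - exact: measurableD.
  - move=> x [xa /negP]; rewrite /cball /= -ltNge => bx _; apply: weight_nonincr => //.
      by rewrite (ltW bx) andbT; case/andP: ba.
    by apply: (le_lt_trans xa); rewrite /a; lra.
  rewrite EFinM -muleA lee_wpmul2l//.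
  have -> : (cball a `\` cball b) `&` cball 1 = [set: n.-tuple R] `&` cball a `\` cball b.
    rewrite setTI; apply/setIidl => x [xa _].
    by rewrite /cball /=; apply: (le_trans xa); rewrite /a; lra.
  rewrite vol_shell// setTI lee_wpmul2r// lee_fin.
  exact: shell_fraction.
(* Inside radius b the weight is at most g0, its value on the inner boundary
   of the shell. *)
have WT : (beta_weight beta [set: n.-tuple R] <=
    g0%:E * vol n (@cball R n 1) + beta_weight beta D)%E.
  have -> : beta_weight beta [set: n.-tuple R] =
      (beta_weight beta (@cball R n b) + beta_weight beta D)%E.
    rewrite !beta_weightE -ge0_integral_setU//.
    - congr (integral _ _ _); rewrite -setIUl; congr (_ `&` _).
      apply/seteqP; split => // x _; rewrite /setU /= SE /cball /=.
      by case: (leP (enorm x) b) => _; [left|right].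
    - exact: measurableI.
    - exact: measurableI.
    - exact: measurable_weight_enorm.
    - by move=> x _; rewrite lee_fin weight_ge0.
    - apply/disj_setPS => x [[xb _] [Dx _]]; move: Dx; rewrite SE ltNge.
      by rewrite /cball /= in xb; rewrite xb.
  rewrite leeD2r//; apply: le_trans (@beta_weight_le_cst n beta g0 (cball b) (mB b) g00 _) _.
    move=> x xb _; apply: weight_nonincr => //; last by rewrite /b; lra.
    by rewrite enorm_ge0 xb.
  by rewrite lee_wpmul2l//; apply: le_vol => x [].
apply: (@le_trans _ _ ((tau / 9)%:E * (g0%:E * vol n (@cball R n 1) + beta_weight beta D))%E).
  by rewrite lee_wpmul2l// lee_fin divr_ge0// ltW.
rewrite ge0_muleDr ?mule_ge0//.
apply: (@le_trans _ _ ((8 / 9)%:E * beta_weight beta D + (1 / 9)%:E * beta_weight beta D)%E).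
  apply: leeD.
    rewrite muleA -EFinM (_ : tau / 9 * g0 = 8 / 9 * (g0 * (tau / 8))); last by field.
    by rewrite EFinM -muleA lee_wpmul2l// lee_fin divr_ge0.
  by rewrite lee_wpmul2r// lee_fin ler_pM2r.
rewrite -ge0_muleDl// ?lee_fin ?divr_ge0//.
by rewrite -EFinD (_ : 8 / 9 + 1 / 9 = 1 :> R) ?mul1e//; field.
Qed.

(** The exponent beta + n / 2 + 2 serves both signs of beta: it exceeds
    beta + n / 2 + 1, needed for beta >= 0, and n / 2 + 1, needed for beta < 0. *)
Lemma beta_weight_ocap_ge beta : -1 < beta ->
  (((tau / 64) `^ (beta + n%:R / 2 + 2))%:E * beta_weight beta [set: n.-tuple R] <=
   beta_weight beta (ocap u (1 - tau)))%E.
Proof.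
move=> b1; have t0 := tau0; have t1 := tau1.
have W0 : (0 <= beta_weight beta [set: n.-tuple R])%E.
  by apply: integral_ge0 => x _; rewrite lee_fin powR_ge0.
have t64 : 0 < tau / 64 by rewrite divr_gt0.
have t641 : tau / 64 <= 1 by lra.
have nz (x : R) : (x == 0) ==> (tau / 64 != 0) by rewrite (gt_eqF t64) implybT.
have -> : (tau / 64) `^ (beta + n%:R / 2 + 2) =
    (q / 8) ^+ n * (tau / 64) `^ beta * (tau / 64) ^+ 2.
  rewrite powRD// (powRD (r := beta))// powR_mulrn ?ltW// (mulrC ((q / 8) ^+ n)).
  rewrite (@exprn_powR_half _ n (q / 8)) ?divr_ge0 ?ltW//.
  by congr (_ * _ `^ _ * _); lra.
have qn : 0 <= (q / 8) ^+ n by rewrite exprn_ge0// divr_ge0// ltW.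
have [b0|/ltW b0] := leP 0 beta.
  apply: le_trans (beta_weight_ocap_pos b0); rewrite lee_wpmul2r// lee_fin.
  rewrite [leRHS]mulrC -mulrA ler_wpM2l// ler_pM ?powR_ge0 ?sqr_ge0//.
    by apply: ge0_ler_powR; rewrite ?nnegrE//; lra.
  have : tau * tau <= tau * 1 by rewrite ler_pM2l.
  by lra.
apply: le_trans (beta_weight_ocap_neg b0); rewrite lee_wpmul2r// lee_fin.
rewrite [leRHS]mulrC -mulrA ler_wpM2l//.
rewrite -[(tau / 64) ^+ 2]powR_mulrn ?(ltW t64)// -powRD//.
apply: (@le_trans _ _ ((tau / 64) `^ 1)).
  by apply: ger_powR; rewrite ?t64 //; lra.
by rewrite powRr1 ?ltW//; lra.
Qed.

End cap_lower.

(** * Convex hulls of finitely many points *)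

Section hull.
Context {R : realType} {n : nat}.
Implicit Types (x y u : n.-tuple R).

Lemma convex_hull_dot_lt (A : set (n.-tuple R)) x v c :
  (forall y, A y -> dot y v < c) -> convex_hull A x -> dot x v < c.
Proof.
move=> Ac hx; apply: (hx [set y | dot y v < c]); split=> [y z t yc zc /andP[t0 t1]|//] /=.
have -> : dot [tuple (1 - t) * tnth y i + t * tnth z i | i < n] v =
    (1 - t) * dot y v + t * dot z v.
  rewrite /dot !mulr_sumr -big_split /=; apply: eq_bigr => i _.
  by rewrite tnth_mktuple mulrDl !mulrA.
have [->|tn0] := eqVneq t 0; first by rewrite subr0 mul1r mul0r addr0.
have t00 : 0 < t by rewrite lt_def tn0.
have h1 : (1 - t) * dot y v <= (1 - t) * c by rewrite ler_wpM2l ?subr_ge0// ltW.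
have h2 : t * dot z v < t * c by rewrite ltr_pM2l.
lra.
Qed.

Definition comb N (X : 'I_N -> n.-tuple R) (l : 'I_N -> R) : n.-tuple R :=
  [tuple \sum_(i < N) l i * tnth (X i) k | k < n].

Lemma is_convex_comb (C : set (n.-tuple R)) N (X : 'I_N -> n.-tuple R) (l : 'I_N -> R) :
  is_convex C -> (forall i, C (X i)) -> (forall i, 0 <= l i) -> \sum_(i < N) l i = 1 ->
  C (comb X l).
Proof.
move=> cC; elim: N X l => [|N IHN] X l CX l0.
  by rewrite big_ord0 => /esym/eqP; rewrite oner_eq0.
rewrite big_ord_recl; set S := \sum_(i < N) _ => lS.
have S0 : 0 <= S by exact: sumr_ge0.
have [SE|Sn0] := eqVneq S 0.
  have lz i : l (lift ord0 i) = 0.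
    by move/psumr_eq0P : SE => /(_ (fun i _ => l0 (lift ord0 i)))/(_ i isT).
  rewrite (_ : comb X l = X ord0)//; apply: eq_from_tnth => k; rewrite tnth_mktuple.
  rewrite big_ord_recl big1 ?addr0; last by move=> i _; rewrite lz mul0r.
  by move: lS; rewrite SE addr0 => ->; rewrite mul1r.
have -> : comb X l = [tuple (1 - S) * tnth (X ord0) k +
    S * tnth (comb (fun i => X (lift ord0 i)) (fun i => l (lift ord0 i) / S)) k | k < n].
  apply: eq_from_tnth => k; rewrite !tnth_mktuple big_ord_recl -lS addrK; congr (_ + _).
  rewrite mulr_sumr; apply: eq_bigr => i _; rewrite mulrA; congr (_ * _).
  by rewrite mulrC divfK.
apply: cC => //; last by rewrite S0 -lS lerDr l0.
apply: IHN => [i|i|]; [exact: CX|by rewrite divr_ge0|].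
by rewrite -mulr_suml divff.
Qed.

Lemma convex_hull_comb N (X : 'I_N -> n.-tuple R) (l : 'I_N -> R) :
  (forall i, 0 <= l i) -> \sum_(i < N) l i = 1 ->
  convex_hull [set X i | i in [set: 'I_N]] (comb X l).
Proof. by move=> l0 l1 C [cC XC]; apply: is_convex_comb => // i; apply: XC; exists i. Qed.

Lemma dot_aff_sqr x y t : dot (aff x t y) (aff x t y) =
  dot x x + 2 * t * dot x y + t ^+ 2 * dot y y.
Proof. by rewrite !(dot_affl, dot_affr) (dotC y x); ring. Qed.

Definition vsub x y : n.-tuple R := aff x (-1) y.

Lemma dot_vsubl x y v : dot (vsub x y) v = dot x v - dot y v.
Proof. by rewrite /vsub dot_affl mulN1r. Qed.

Lemma dot_vsubr x y v : dot v (vsub x y) = dot v x - dot v y.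
Proof. by rewrite /vsub dot_affr mulN1r. Qed.

Let simplex N : set 'rV[R]_N :=
  [set l | forall i, `[0, 1]%classic (l ord0 i)] `&` [set l | \sum_(i < N) l ord0 i = 1].

Lemma continuous_big_sum (T : topologicalType) (I : Type) (r : seq I) (F : I -> T -> R) :
  (forall i, continuous (F i)) -> continuous (fun t => \sum_(i <- r) F i t).
Proof.
move=> cF; elim: r => [|i r IHr].
  rewrite (_ : (fun _ => _) = cst 0)//; first exact: cst_continuous.
  by apply/funext => t; rewrite big_nil.
rewrite (_ : (fun _ => _) = (fun t => F i t + \sum_(j <- r) F j t)).
  by move=> t; apply: continuousD; [exact: cF|exact: IHr].
by apply/funext => t; rewrite big_cons.
Qed.

Let compact_simplex N : compact (@simplex N).
Proof.
apply: compact_closedI.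
  by apply: (@rV_compact R N (fun=> `[0, 1]%classic)) => i; exact: segment_compact.
apply: (@closed_comp _ _ (fun l : 'rV[R]_N => \sum_(i < N) l ord0 i) [set x | x = 1]);
  last exact: closed_eq.
by move=> l _; apply: continuous_big_sum => i; exact: coord_continuous.
Qed.

(** First-order condition at the end t = 0 of a segment. *)
Lemma quadratic_le0 (a b : R) : 0 <= b ->
  (forall t, 0 <= t <= 1 -> 2 * t * a <= t ^+ 2 * b) -> a <= 0.
Proof.
move=> b0 h; rewrite leNgt; apply/negP => a0.
have b1 : 0 < a + b + 1 by lra.
pose t := a / (a + b + 1).
have t0 : 0 < t by rewrite divr_gt0.
have t1 : t <= 1 by rewrite ler_pdivrMr// mul1r; lra.
have := h t; rewrite (ltW t0) t1 => /(_ isT).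
rewrite expr2 -mulrA mulrCA -[X in _ <= X]mulrA ler_pM2l//.
have : t * b <= a.
  rewrite /t mulrAC ler_pdivrMr// ler_pM2l//; lra.
lra.
Qed.

(** The squared distance to x attains its minimum on the compact simplex of
    coefficients, and x minus the nearest combination is the separating
    direction: moving from there towards X_i cannot decrease the distance. *)
Lemma convex_hull_separation N (X : 'I_N -> n.-tuple R) x : (0 < N)%N ->
  ~ convex_hull [set X i | i in [set: 'I_N]] x ->
  exists2 u, enorm u = 1 & forall i, dot (X i) u <= dot x u.
Proof.
move=> N0 xX; pose i0 := Ordinal N0.
pose p (l : 'rV[R]_N) := comb X (l ord0).
pose f l := dot (vsub x (p l)) (vsub x (p l)).
have cf : continuous f.
  have -> : f = fun l => \sum_(k <- index_enum 'I_n)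
      ((tnth x k - \sum_(i <- index_enum 'I_N) l ord0 i * tnth (X i) k) *
       (tnth x k - \sum_(i <- index_enum 'I_N) l ord0 i * tnth (X i) k)).
    by apply/funext => l; apply: eq_bigr => k _; rewrite !tnth_mktuple mulN1r.
  apply: continuous_big_sum => k.
  have ck : continuous (fun l : 'rV[R]_N =>
      tnth x k - \sum_(i <- index_enum 'I_N) l ord0 i * tnth (X i) k).
    have cs : continuous (fun l : 'rV[R]_N =>
        \sum_(i <- index_enum 'I_N) l ord0 i * tnth (X i) k).
      apply: continuous_big_sum => i l.
      apply: (@continuousM _ _ (fun l : 'rV[R]_N => l ord0 i) (cst (tnth (X i) k))).
        exact: coord_continuous.
      exact: cst_continuous.
    move=> l; apply: (@continuousB _ _ _ (cst (tnth x k))); last exact: cs.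
    exact: cst_continuous.
  by move=> l; apply: (continuousM (ck l) (ck l)).
have S0 : @simplex N !=set0.
  exists (\row_i (i == i0)%:R); split => [i|] /=.
    by rewrite mxE in_itv/=; case: eqP => _; rewrite ?lexx ler01.
  under eq_bigr do rewrite mxE; rewrite (bigD1 i0)//= ?eqxx big1 ?addr0// => i /negbTE ->.
  by [].
have [l /set_mem[l01 l1] lmin] := EVT_min_rV S0 (@compact_simplex N) (continuous_subspaceT cf).
set w := vsub x (p l).
have lge i : 0 <= l ord0 i by have := l01 i; rewrite /= in_itv/= => /andP[].
have w0 : 0 < enorm w.
  rewrite lt_def enorm_ge0 andbT; apply/eqP => w0; apply: xX.
  rewrite (_ : x = p l); first exact: convex_hull_comb.
  apply: eq_from_tnth => k; apply/eqP; rewrite -subr_eq0 -normr_le0 -w0.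
  by apply: le_trans (coord_le_enorm w k); rewrite !tnth_mktuple mulN1r.
have key i : dot (X i) w <= dot (p l) w.
  rewrite -subr_le0; apply: (@quadratic_le0 _ (dot (vsub (X i) (p l)) (vsub (X i) (p l)))).
    exact: dotvv_ge0.
  move=> t /andP[t0 t1].
  pose lt : 'rV[R]_N := \row_j ((1 - t) * l ord0 j + t * (j == i)%:R).
  have ltS : lt \in @simplex N.
    apply/mem_set; split => [j|] /=; rewrite ?mxE.
      rewrite in_itv/=; have := l01 j; rewrite /= in_itv/= => /andP[lj0 lj1].
      have : 0 <= (1 - t) * l ord0 j by rewrite mulr_ge0// subr_ge0.
      have : (1 - t) * l ord0 j <= 1 - t by rewrite ler_piMr// subr_ge0.
      by case: eqP => _ /=; lra.
    under eq_bigr do rewrite mxE; rewrite big_split /= -!mulr_sumr l1.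
    rewrite (bigD1 i)//= ?eqxx big1 ?addr0 => [|j /negbTE->//]; rewrite mulr1n; lra.
  have := lmin _ ltS; rewrite /f.
  have -> : vsub x (p lt) = aff w (- t) (vsub (X i) (p l)).
    apply: eq_from_tnth => k; rewrite !tnth_mktuple.
    under eq_bigr do rewrite mxE mulrDl -!mulrA.
    rewrite big_split /= -!mulr_sumr [\sum_(j < N) (j == i)%:R * _](bigD1 i)//=.
    rewrite eqxx mulr1n mul1r [\sum_(j < N | j != i) _]big1 ?addr0.
      by ring.
    by move=> j /negbTE ->; rewrite mul0r.
  rewrite -/w dot_aff_sqr (dotC w) (dot_vsubl (X i)); lra.
have xp : dot (p l) w <= dot x w by rewrite -subr_ge0 -dot_vsubl dotvv_ge0.
exists (aff (zerov n) (enorm w)^-1 w).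
  by rewrite enorm_scale ?invr_ge0 ?(ltW w0)// mulVf// gt_eqF.
have scaleE y c : dot y (aff (zerov n) c w) = c * dot y w by rewrite dot_affr dotv0 add0r.
move=> i; rewrite !scaleE ler_pM2l ?invr_gt0//.
exact: le_trans (key i) xp.
Qed.

End hull.

(** * A net on the sphere *)

Section net.
Context {R : realType}.

Lemma unit_vector_exists n : (0 < n)%N -> exists u : n.-tuple R, enorm u = 1.
Proof.
case: n => // n _; exists [tuple (i == ord0)%:R | i < n.+1].
rewrite /enorm big_ord_recl tnth_mktuple big1; first by rewrite addr0 expr1n sqrtr1.
by move=> i _; rewrite tnth_mktuple /= expr0n.
Qed.

(** Divide [-1, 1]^n into cells of side 1 / k, hence of diameter at most n / k, and
    choose a unit vector in each cell that contains one. *)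
Lemma sphere_net n k (eta : R) : (0 < n)%N -> (0 < k)%N -> n%:R <= k%:R * eta ->
  exists2 v : {ffun 'I_n -> 'I_(2 * k).+1} -> n.-tuple R,
    forall c, enorm (v c) = 1 &
    forall u, enorm u = 1 -> exists c, enorm (vsub u (v c)) <= eta.
Proof.
move=> n0 k0 nk; have kR : (0 : R) < k%:R by rewrite ltr0n.
pose cell (u : n.-tuple R) : {ffun 'I_n -> 'I_(2 * k).+1} :=
  [ffun i => inord (Num.truncn ((tnth u i + 1) * k%:R))].
have [u0 u01] := unit_vector_exists n0.
have /choice[v vP] : forall c, exists v : n.-tuple R, enorm v = 1 /\
    (forall u, enorm u = 1 -> cell u = c -> cell v = c).
  move=> c; have [[u u1 uc]|h] := pselect (exists2 u, enorm u = 1 & cell u = c).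
    by exists u; split.
  by exists u0; split => // u u1 uc; exfalso; apply: h; exists u.
exists v; first by move=> c; case: (vP c).
move=> u u1; exists (cell u); have [v1 /(_ u u1 erefl)] := vP (cell u).
set w := v _ in v1 * => wu.
have dist i : `|tnth u i - tnth w i| <= k%:R^-1.
  have bnd (z : n.-tuple R) : enorm z = 1 ->
      0 <= (tnth z i + 1) * k%:R /\ (Num.truncn ((tnth z i + 1) * k%:R) < (2 * k).+1)%N.
    move=> z1; have := coord_le_enorm z i; rewrite z1 ler_norml => /andP[z0 z2].
    have h0 : 0 <= (tnth z i + 1) * k%:R by rewrite mulr_ge0// -lerBlDr sub0r.
    split=> //; rewrite truncn_lt_nat//.
    apply: (@le_lt_trans _ _ (2 * k%:R)); first by rewrite ler_pM2r//; lra.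
    by rewrite -natrM ltr_nat.
  have [u0' ub] := bnd u u1; have [w0' wb] := bnd w v1.
  have : Num.truncn ((tnth w i + 1) * k%:R) = Num.truncn ((tnth u i + 1) * k%:R).
    have /(congr1 (fun f : {ffun 'I_n -> 'I_(2 * k).+1} => nat_of_ord (f i))) := wu.
    by rewrite !ffunE !inordK.
  set t := Num.truncn _; have := truncnS_gt ((tnth w i + 1) * k%:R).
  have := truncnS_gt ((tnth u i + 1) * k%:R).
  move: w0' u0'; rewrite -!truncn_le -/t => w2 u2 + + E.
  rewrite -E -/t in u2 *; rewrite -natr1 => ? ?.
  have : `|(tnth u i - tnth w i) * k%:R| <= 1 by rewrite ler_norml; lra.
  by rewrite normrM (gtr0_norm kR) -ler_pdivlMr// div1r.
have eta0 : 0 <= eta.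
  by rewrite -(pmulr_rge0 _ kR); apply: le_trans nk; exact: ler0n.
rewrite enorm_le//; apply: (@le_trans _ _ (\sum_(i < n) (k%:R^-1) ^+ 2)).
  apply: ler_sum => i _; rewrite tnth_mktuple mulN1r -expr2 -real_normK ?num_real//.
  by rewrite ler_sqr ?nnegrE ?normr_ge0 ?invr_ge0//; exact: dist.
rewrite sumr_const card_ord -[_ *+ n]mulr_natl.
apply: (@le_trans _ _ ((n%:R / k%:R) ^+ 2)).
  rewrite exprMn ler_wpM2r ?sqr_ge0// expr2 -natrM ler_nat.
  by rewrite -[X in (X <= _)%N]muln1 leq_mul.
by rewrite ler_sqr ?nnegrE ?divr_ge0// ler_pdivrMr// mulrC.
Qed.

End net.

(** * Bounds for the expected volume *)

Section expectation.
Context {R : realType} {d : measure_display} {Omega : measurableType d}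
  (P : probability Omega R) {n N : nat}.
Variable X : 'I_N -> {RV P >-> n.-tuple R}.
Variable beta : R.
Hypotheses (n_gt0 : (0 < n)%N) (N_gt0 : (0 < N)%N).
Hypothesis indX : independent_points X.
Hypothesis distX : beta_distributed X beta.

Local Notation W := (@beta_weight R n beta).

Lemma beta_weight_ge0 A : (0 <= W A)%E.
Proof. by apply: integral_ge0 => x _; rewrite lee_fin powR_ge0. Qed.

(** The distribution of a point has total mass 1, whereas with the conventions for
    the inverses of 0 and of +oo both 0 / 0 and +oo / +oo are 0. *)
Lemma beta_weight_total : exists2 w : R, 0 < w & W setT = w%:E.
Proof.
have := distX (Ordinal N_gt0) measurableT.
rewrite /distribution /pushforward preimage_setT probability_setT /beta_distribution.
have := beta_weight_ge0 setT; case: (W setT) => [w| |] //.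
  rewrite lee_fin le_eqVlt => /orP[/eqP <-|w0 _]; last by exists w.
  by rewrite mul0e => /eqP; rewrite eqe oner_eq0.
by rewrite invey mule0 => _ /eqP; rewrite eqe oner_eq0.
Qed.

Let prob_le i A q : measurable A -> (W A <= q%:E * W setT)%E ->
  (P (X i @^-1` A) <= q%:E)%E.
Proof.
move=> mA; have [w w0 wE] := beta_weight_total.
have := distX i mA; rewrite /distribution /pushforward => ->.
by rewrite /beta_distribution wE inver gt_eqF// => h; rewrite lee_pdivrMr.
Qed.

Let prob_ge i A p : measurable A -> (p%:E * W setT <= W A)%E ->
  (p%:E <= P (X i @^-1` A))%E.
Proof.
move=> mA; have [w w0 wE] := beta_weight_total.
have := distX i mA; rewrite /distribution /pushforward => ->.
by rewrite /beta_distribution wE inver gt_eqF// => h; rewrite lee_pdivlMr.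
Qed.

Let mX i : measurable_fun setT (X i).
Proof. by []. Qed.

(** The pairs (w, x) for which X_i(w) lies in the half-space of the points beyond
    the hyperplane through x orthogonal to x. *)
Let facing (r : R) i : set (Omega * n.-tuple R) :=
  [set p | r < enorm p.2] `&` [set p | dot p.2 p.2 <= dot (X i p.1) p.2].

Let measurable_facing r i : measurable (facing r i).
Proof.
apply: measurableI.
  by apply: measurable_set_lt => //; exact: measurable_fun_enorm.
apply: measurable_set_le; apply: measurable_fun_dot => //.
by apply: measurableT_comp => //.
Qed.

(** For |x| > 1 the half-space does not meet B; for r < |x| <= 1 it cuts a cap
    contained in the cap at distance r. *)
Let prob_facing (r q : R) i x : 0 <= r -> 0 <= q ->
  (r < 1 -> forall u : n.-tuple R, enorm u = 1 -> (W (cap u r) <= q%:E * W setT)%E) ->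
  (P (ysection (facing r i) x) <= q%:E * (\1_(cball 1) x)%:E)%E.
Proof.
move=> r0 q0 hq.
have rhs0 : (0 <= q%:E * (\1_(@cball R n 1) x)%:E)%E by rewrite mule_ge0 ?lee_fin.
have [xr|rx] := leP (enorm x) r.
  rewrite (_ : ysection _ _ = set0) ?measure0//.
  by apply/seteqP; split => w //; rewrite /ysection /= inE /facing /= ltNge xr => -[].
have -> : ysection (facing r i) x = X i @^-1` [set y | dot x x <= dot y x].
  by apply/seteqP; split => w; rewrite /ysection /= inE /facing /= => // -[].
have mA : measurable [set y : n.-tuple R | dot x x <= dot y x].
  by apply: measurable_set_le => //; exact: measurable_fun_dot.
have e0 : 0 < enorm x by exact: le_lt_trans rx.
have [x1|x1] := leP (enorm x) 1.
  rewrite indicE mem_set// mule1; apply: prob_le => //.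
  have u1 : enorm (aff (zerov n) (enorm x)^-1 x) = 1.
    by rewrite enorm_scale ?invr_ge0 ?(ltW e0)// mulVf// gt_eqF.
  apply: le_trans (hq _ _ u1); last exact: lt_le_trans x1.
  apply: le_beta_weight => //; first exact: measurable_cap.
  move=> y [/= xy _]; rewrite /cap /= dot_affr dotv0 add0r.
  rewrite -sqr_enorm in xy; rewrite mulrC ler_pdivlMr//.
  by apply: le_trans xy; rewrite expr2 ler_pM2r// ltW.
rewrite indicE memNset; last by rewrite /cball /=; apply/negP; rewrite -ltNge.
rewrite mule0; apply: prob_le => //; rewrite mul0e /beta_weight.
rewrite (_ : _ `&` _ = set0) ?integral_set0//.
apply/seteqP; split => y //= [y1 xy]; have := le_trans xy (dot_le y x).
rewrite -sqr_enorm expr2 ler_pM2r// => xy1.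
by have := lt_le_trans x1 (le_trans xy1 y1); rewrite ltxx.
Qed.

Let hull_sub r w : random_polytope X w `<=`
  cball r `|` \big[setU/set0]_(i < N) xsection (facing r i) w.
Proof.
move=> x hx; have [xr|rx] := leP (enorm x) r; [by left|right].
rewrite -bigcup_seq; apply: contrapT => hn.
suff : dot x x < dot x x by rewrite ltxx.
apply: convex_hull_dot_lt hx => _ [i _ <-]; rewrite ltNge; apply/negP => h.
by apply: hn; exists i; [rewrite /= mem_index_enum|rewrite /xsection /= inE].
Qed.

(** By Fubini, the expected volume of the points x beyond r faced by X_i is the
    integral over x of the probability that X_i faces x. *)
Lemma expected_volume_le (r q : R) : 0 <= r -> 0 <= q ->
  (r < 1 -> forall u : n.-tuple R, enorm u = 1 -> (W (cap u r) <= q%:E * W setT)%E) ->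
  (expected_volume X <= vol n (cball r) + (N%:R * q)%:E * vol n (@cball R n 1))%E.
Proof.
move=> r0 q0 hq.
have mB t := @measurable_cball R n t.
have mF i w : measurable (xsection (facing r i) w) by exact: measurable_xsection.
have mg i : measurable_fun setT (fun w => vol n (xsection (facing r i) w)).
  exact: (@measurable_fun_xsection _ _ Omega (n.-tuple R) R (vol n) _ (measurable_facing r i)).
apply: (@le_trans _ _ (\int[P]_w (vol n (cball r) +
    \sum_(i < N) vol n (xsection (facing r i) w)))%E).
  apply: ge0_le_integral_arbitrary => w //.
  apply: (le_trans (le_vol (@hull_sub r w))).
  apply: (le_trans (measureU2 _ _ _)) => //; first exact: bigsetU_measurable.
  rewrite leeD2l//.
  elim: (index_enum _) => [|i s IHs]; first by rewrite !big_nil measure0.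
  rewrite !big_cons; apply: (le_trans (measureU2 _ _ _)) => //.
    exact: bigsetU_measurable.
  by rewrite leeD2l.
rewrite ge0_integralD//; last 2 first.
- by move=> w _; apply: sume_ge0.
- exact: emeasurable_sum.
rewrite integral_cst//= probability_setT mule1 leeD2l//.
rewrite ge0_integral_sum//.
apply: (@le_trans _ _ (\sum_(i < N) q%:E * vol n (@cball R n 1))%E); last first.
  have fB : vol n (@cball R n 1) \is a fin_num by exact: vol_cball1_fin.
  by rewrite -(fineK fB) -!EFinM sumEFin sumr_const card_ord -[(q * _) *+ N]mulr_natl mulrA.
apply: lee_sum => i _.
have := indic_fubini_tonelli P (vol n) (measurable_facing r i).
rewrite indic_fubini_tonelli_FE// indic_fubini_tonelli_GE// => ->.
have -> : vol n (@cball R n 1) = (\int[vol n]_x (\1_(cball 1) x)%:E)%E.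
  by rewrite integral_indic// setIT.
rewrite -ge0_integralZl//; last by apply/measurable_EFinP; exact: measurable_indic.
by apply: ge0_le_integral_arbitrary => x //; exact: prob_facing.
Qed.

(** The term eta |y| pays for replacing a direction by one at distance eta; on B
    the complement contains the cap at distance r + eta. *)
Let missed r eta (v : n.-tuple R) : set (n.-tuple R) :=
  [set y | dot y v <= r + eta * enorm y].

Let measurable_missed r eta v : measurable (missed r eta v).
Proof.
apply: measurable_set_le; first exact: measurable_fun_dot.
by apply: measurable_funD => //; apply: measurable_funM => //; exact: measurable_fun_enorm.
Qed.

Let miss r eta v : set Omega := [set w | forall i, missed r eta v (X i w)].

Let missE r eta v : miss r eta v =
  [set w | forall i, i \in [set: 'I_N]%SET -> missed r eta v (X i w)].
Proof.
by apply/seteqP; split=> w /= h i => [_|]; [exact: h|apply: h; rewrite inE].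
Qed.

Let measurable_miss r eta v : measurable (miss r eta v).
Proof.
have -> : miss r eta v = \bigcap_(i in [set: 'I_N]) (X i @^-1` missed r eta v).
  by apply/seteqP; split=> w h i; [move=> _|]; exact: h.
apply: fin_bigcap_measurable => [|i _]; first exact: finite_finset.
by apply: measurable_preimage.
Qed.

Let prob_miss r eta p v : 0 <= p <= 1 -> 0 <= eta -> enorm v = 1 ->
  (p%:E * W setT <= W (ocap v (r + eta)))%E ->
  (P (miss r eta v) <= ((1 - p) ^+ N)%:E)%E.
Proof.
move=> /andP[p0 p1] eta0 v1 hp; have mM := measurable_missed r eta v.
have hi i : (P (X i @^-1` missed r eta v) <= (1 - p)%:E)%E.
  have : (p%:E <= P (X i @^-1` (~` missed r eta v)))%E.
    apply: prob_ge; first exact: measurableC.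
    apply: (le_trans hp); apply: le_beta_weight; [exact: measurable_ocap|exact: measurableC|].
    move=> y [/= ry y1]; rewrite /missed /ocap /= in ry *; apply/negP; rewrite -ltNge.
    by apply: le_lt_trans ry; rewrite lerD2l; apply: ler_piMr => //; exact: y1.
  rewrite preimage_setC probability_setC; last exact: measurable_preimage (mX i) mM.
  have fA : P (X i @^-1` missed r eta v) \is a fin_num.
    by apply: fin_num_measure; exact: measurable_preimage (mX i) mM.
  by rewrite -(fineK fA) -EFinB !lee_fin; lra.
rewrite missE (indX [set: 'I_N]%SET (fun=> mM)).
have : (0 <= \prod_(i in [set: 'I_N]%SET) P (X i @^-1` missed r eta v) /\
  \prod_(i in [set: 'I_N]%SET) P (X i @^-1` missed r eta v) <=
  \prod_(i in [set: 'I_N]%SET) (1 - p)%:E)%E.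
  elim/big_ind2: _ => // x1 x2 y1 y2 [x10 x12] [y10 y12].
  by split; [exact: mule_ge0|exact: lee_pmul].
by case=> _ /le_trans; apply; rewrite prodEFin prodr_const cardsT card_ord.
Qed.

(** Outside the event that all points miss the half-space of some vector of the
    net, the polytope contains the ball of radius r. *)
Lemma expected_volume_ge (r eta p : R) k : 0 <= r -> 0 <= eta -> 0 <= p <= 1 -> (0 < k)%N ->
  n%:R <= k%:R * eta ->
  (forall u : n.-tuple R, enorm u = 1 -> (p%:E * W setT <= W (ocap u (r + eta)))%E) ->
  ((1 - ((2 * k).+1 ^ n)%:R * (1 - p) ^+ N)%:E * vol n (@cball R n r) <= expected_volume X)%E.
Proof.
move=> r0 eta0 p01 k0 nk hp.
have mB t := @measurable_cball R n t.
have [v v1 vnet] := sphere_net n_gt0 k0 nk.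
pose T : finType := {ffun 'I_n -> 'I_(2 * k).+1}.
pose bad : set Omega := \big[setU/set0]_(c : T) miss r eta (v c).
have mbad : measurable bad by exact: bigsetU_measurable.
have Pbad : (P bad <= (((2 * k).+1 ^ n)%:R * (1 - p) ^+ N)%:E)%E.
  apply: (@le_trans _ _ (\sum_(c : T) ((1 - p) ^+ N)%:E)%E); last first.
    by rewrite sumEFin sumr_const card_ffun !card_ord mulr_natl.
  rewrite /bad; elim: (index_enum _) => [|c s IHs]; first by rewrite !big_nil measure0.
  rewrite !big_cons; apply: (le_trans (measureU2 _ _ _)) => //.
    exact: bigsetU_measurable.
  by apply: leeD => //; apply: prob_miss => //; exact: hp.
have good w : ~ bad w -> cball r `<=` random_polytope X w.
  move=> nb x xr; apply: contrapT => xX; apply: nb.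
  have [u u1 uX] := convex_hull_separation N_gt0 xX.
  have [c uc] := vnet u u1.
  rewrite /bad (bigD1 c)//=; left => i; rewrite /missed /=.
  have : dot (X i w) (vsub (v c) u) <= eta * enorm (X i w).
    apply: (le_trans (dot_le _ _)); rewrite mulrC ler_wpM2r ?enorm_ge0//.
    rewrite (_ : enorm _ = enorm (vsub u (v c)))// /enorm; congr Num.sqrt.
    by apply: eq_bigr => j _; rewrite !tnth_mktuple !mulN1r -sqrrN opprB.
  rewrite dot_vsubr; have := uX i; have := dot_le x u; rewrite u1 mulr1.
  by rewrite /cball /= in xr; lra.
apply: (@le_trans _ _ (\int[P]_w (vol n (cball r) * (\1_(~` bad) w)%:E))%E); last first.
  apply: ge0_le_integral_arbitrary => w; first by rewrite mule_ge0// lee_fin.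
  rewrite indicE; case: (boolP (w \in _)) => [/set_mem /good h|_].
    by rewrite mule1; exact: le_vol.
  by rewrite mule0.
rewrite ge0_integralZl//; last first.
  by apply/measurable_EFinP; apply: measurable_indic; exact: measurableC.
rewrite integral_indic ?setIT//; last exact: measurableC.
rewrite muleC lee_wpmul2l//.
apply: (@le_trans _ _ (1 - P bad)%E); first by rewrite EFinB leeB.
by rewrite -probability_setC.
Qed.

End expectation.

Section ratio_bounds.
Context {R : realType} {d : measure_display} {Omega : measurableType d}
  (P : probability Omega R) {n N : nat}.
Variable X : 'I_N -> {RV P >-> n.-tuple R}.
Variable beta : R.
Hypotheses (n_gt0 : (0 < n)%N) (N_gt0 : (0 < N)%N).
Hypothesis indX : independent_points X.
Hypothesis distX : beta_distributed X beta.

Local Notation W := (@beta_weight R n beta).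
Local Notation ratio := (expected_volume X / vol n (unit_ball n))%E.

Let ballE : exists2 v : R, 0 < v & vol n (unit_ball n) = v%:E.
Proof.
have fB : vol n (@cball R n 1) \is a fin_num by exact: vol_cball1_fin.
exists (fine (vol n (@cball R n 1))); last by rewrite fineK.
by rewrite fine_gt0// vol_cball1_gt0 vol_cball_fin.
Qed.

Let vol_cballE r : 0 <= r -> vol n (cball r) = ((r ^+ n)%:E * vol n (@cball R n 1))%E.
Proof.
move=> r0; have cT : conic [set: n.-tuple R] by [].
by have := vol_cone_cball_ge0 cT measurableT r0; rewrite !setTI.
Qed.

Lemma ratio_ge0 : (0 <= ratio)%E.
Proof.
have [v v0 ->] := ballE; rewrite inver gt_eqF// mule_ge0 ?lee_fin ?invr_ge0 ?(ltW v0)//.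
by apply: integral_ge0 => w _; exact: measure_ge0.
Qed.

Lemma ratio_le (r q : R) : 0 <= r -> 0 <= q ->
  (r < 1 -> forall u : n.-tuple R, enorm u = 1 -> (W (cap u r) <= q%:E * W setT)%E) ->
  (ratio <= (r ^+ n + N%:R * q)%:E)%E.
Proof.
move=> r0 q0 /(expected_volume_le N_gt0 distX r0 q0); rewrite vol_cballE//.
have [v v0 vE] := ballE; rewrite -/(unit_ball n) vE -!EFinM -EFinD => h.
by rewrite inver gt_eqF// lee_pdivrMr// -EFinM mulrDl.
Qed.

Lemma ratio_le1 : (ratio <= 1)%E.
Proof.
have := @ratio_le 1 0 ler01 (lexx 0); rewrite ltxx.
move/(_ (fun h => False_ind _ (notF h))).
by rewrite expr1n mulr0 addr0.
Qed.

Lemma ratio_ge (r eta p : R) k : 0 <= r -> 0 <= eta -> 0 <= p <= 1 -> (0 < k)%N ->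
  n%:R <= k%:R * eta ->
  (forall u : n.-tuple R, enorm u = 1 -> (p%:E * W setT <= W (ocap u (r + eta)))%E) ->
  (((1 - ((2 * k).+1 ^ n)%:R * (1 - p) ^+ N) * r ^+ n)%:E <= ratio)%E.
Proof.
move=> r0 e0 p01 k0 nk /(expected_volume_ge n_gt0 N_gt0 indX distX r0 e0 p01 k0 nk).
rewrite vol_cballE//.
have [v v0 vE] := ballE; rewrite -/(unit_ball n) vE -!EFinM => h.
by rewrite inver gt_eqF// lee_pdivlMr// -EFinM -mulrA.
Qed.

End ratio_bounds.

(** * Asymptotics *)

Section asymptotics.
Context {R : realType} {d : measure_display} {Omega : measurableType d}
  (P : probability Omega R) {n N : nat}.
Variable X : 'I_N -> {RV P >-> n.-tuple R}.
Variables (beta eps : R).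
Hypotheses (n_gt1 : (1 < n)%N) (N_gt0 : (0 < N)%N).
Hypothesis indX : independent_points X.
Hypothesis distX : beta_distributed X beta.
Hypotheses (beta_gt : -1 < beta) (eps01 : 0 < eps < 1).
Hypothesis n_large : 73 <= eps * n%:R.

Local Notation ratio := (expected_volume X / vol n (unit_ball n))%E.
Local Notation kappa := (beta + n.+1%:R / 2).
Local Notation L := (ln n%:R : R).

Let n_gt0 : (0 < n)%N. Proof. exact: ltnW. Qed.
Let nR0 : (0 : R) < n%:R. Proof. by rewrite ltr0n. Qed.

Let L_gt0 : 0 < L. Proof. by rewrite ln_gt0// ltr1n. Qed.

Let expL : expR L = n%:R. Proof. by rewrite lnK// posrE. Qed.

Let kappaE : beta + n%:R / 2 = kappa - 1 / 2.
Proof. by rewrite -natr1; lra. Qed.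

(* eps kappa > eps (n - 1) / 2 >= (73 - 1) / 2; the value 36 is 4 (6 + 3), for the
   exponent eps kappa / 4 - 3 >= 6 of n in the dense regime. *)
Let eps_kappa : 36 <= eps * kappa.
Proof.
case/andP: eps01 => e0 e1; have b1 := beta_gt; have nl := n_large.
have : 0 <= eps * (beta + 1) by rewrite mulr_ge0 ?(ltW e0)//; lra.
by rewrite -natr1; lra.
Qed.

Let eps_kappa_L : 36 * L <= eps * kappa * L.
Proof. by rewrite ler_pM2r//; exact: L_gt0. Qed.

(** Here r^n <= exp (- n s^2 / 2) = exp (- n^(eps / 2) / 2), and the exponent of
    N q in powers of n is at most - (eps / 2) kappa + 1 / 2 <= -1. *)
Lemma ratio_small : N%:R <= expR ((1 - eps) * kappa * L) ->
  (ratio <= (3 * expR (- (eps / 4 * L)))%:E)%E.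
Proof.
move=> NL; case/andP: eps01 => e0 e1; have l0 := L_gt0.
have eL : 0 < eps * L by rewrite mulr_gt0.
have eL1 : eps * L < L by rewrite gtr_pMl.
pose s2 := expR (- (1 - eps / 2) * L); pose s := Num.sqrt s2.
have s20 : 0 < s2 by exact: expR_gt0.
have s21 : s2 <= 1 by rewrite -[leRHS]expR0 ler_expR; lra.
pose r := Num.sqrt (1 - s2).
have r0 : 0 <= r by exact: sqrtr_ge0.
have rE : r ^+ 2 = 1 - s2 by rewrite sqr_sqrtr// subr_ge0.
have sE : s ^+ 2 = s2 by rewrite sqr_sqrtr// ltW.
have s0 : 0 < s by rewrite sqrtr_gt0.
have ns : n%:R^-1 <= 2 * s ^+ 2.
  apply: (@le_trans _ _ s2); last by rewrite sE; lra.
  by rewrite -expL -expRN ler_expR; lra.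
pose q := 2 * s2 `^ (kappa - 1 / 2).
have q0 : 0 <= q by rewrite mulr_ge0 ?powR_ge0.
have capq (u : n.-tuple R) : enorm u = 1 ->
    (beta_weight beta (cap u r) <= q%:E * beta_weight beta [set: n.-tuple R])%E.
  move=> u1; rewrite /q -kappaE -sE; apply: beta_weight_cap_le => //.
  by rewrite rE sE subrK.
apply: (le_trans (ratio_le N_gt0 distX r0 q0 (fun _ => capq))).
rewrite lee_fin.
have rn : r ^+ n <= expR (- (eps / 4 * L)).
  have rexp : r <= expR (- (s2 / 2)).
    rewrite -ler_sqr ?nnegrE ?expR_ge0// rE -expRM_natl.
    by apply: le_trans (expR_ge1Dx _); lra.
  apply: (@le_trans _ _ (expR (- (s2 / 2)) ^+ n)).
    by rewrite lerXn2r ?nnegrE ?expR_ge0.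
  rewrite -expRM_natl ler_expR.
  have : n%:R * s2 = expR (eps / 2 * L).
    by rewrite -[in LHS]expL -expRD; congr expR; lra.
  have := expR_ge1Dx (eps / 2 * L); lra.
have Nq : N%:R * q <= 2 * expR (- L).
  rewrite /q mulrCA ler_pM2l//.
  apply: (@le_trans _ _ (expR ((1 - eps) * kappa * L) * s2 `^ (kappa - 1 / 2))).
    by rewrite ler_wpM2r// powR_ge0.
  rewrite /s2 -expRM -expRD ler_expR; have := eps_kappa_L; lra.
have : expR (- L) <= expR (- (eps / 4 * L)) by rewrite ler_expR; lra.
lra.
Qed.

Hypothesis L_large : ln 64 <= eps / 4 * L.

(** The net has mesh n^-3, since n / tau <= n^3. The constant 64^kappa is absorbed
    by n^(eps kappa / 4), which leaves N p >= n^(eps kappa / 4 - 3) >= n^6,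
    whereas the net has at most exp (2 n^4) vectors. *)
Lemma ratio_big : expR ((1 + eps) * kappa * L) <= N%:R ->
  ((1 - 3 * expR (- (eps / 4 * L)))%:E <= ratio)%E.
Proof.
move=> NL; case/andP: eps01 => e0 e1; have l0 := L_gt0.
have eL : 0 < eps * L by rewrite mulr_gt0.
have eL1 : eps * L < L by rewrite gtr_pMl.
have n2 : (2 : R) <= n%:R by rewrite ler_nat.
pose tau := expR (- (1 + eps / 2) * L); pose q := Num.sqrt tau.
have tau0 : 0 < tau by exact: expR_gt0.
have qE : q ^+ 2 = tau by rewrite sqr_sqrtr// ltW.
have tau2 : tau <= 1 / 2.
  apply: (@le_trans _ _ (expR (- L))); first by rewrite ler_expR; lra.
  by rewrite expRN expL div1r lef_pV2 ?posrE//; lra.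
have q01 : 0 < q <= 1.
  rewrite sqrtr_gt0 tau0 /= -[leRHS]sqrtr1 ler_wsqrtr//; lra.
have ntau : n%:R * tau = expR (- (eps / 2 * L)).
  by rewrite -[in LHS]expL -expRD; congr expR; lra.
pose p := (tau / 64) `^ (beta + n%:R / 2 + 2).
have t64 : 0 < tau / 64 by rewrite divr_gt0.
have p01 : 0 <= p <= 1.
  rewrite powR_ge0 /=; apply: (@le_trans _ _ ((tau / 64) `^ 0)); last by rewrite powRr0.
  apply: ger_powR; first by rewrite t64; lra.
  by rewrite kappaE; have := eps_kappa; nra.
have capp (u : n.-tuple R) : enorm u = 1 ->
    (p%:E * beta_weight beta [set: n.-tuple R] <=
     beta_weight beta (ocap u (1 - 2 * tau + tau)))%E.
  move=> u1; rewrite (_ : 1 - 2 * tau + tau = 1 - q ^+ 2); last by rewrite qE; lra.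
  rewrite /p -qE; apply: beta_weight_ocap_ge => //.
  by rewrite qE ntau -[leRHS]expR0 ler_expR; lra.
have k0 : (0 < n ^ 3)%N by rewrite expn_gt0 n_gt0.
have nk : n%:R <= (n ^ 3)%:R * tau.
  rewrite natrX -[in leRHS]expL -expRM_natl -expRD -[leLHS]expL ler_expR; lra.
have r0 : 0 <= 1 - 2 * tau by lra.
have := ratio_ge n_gt0 N_gt0 indX distX r0 (ltW tau0) p01 k0 nk capp.
apply: le_trans; rewrite lee_fin.
have rn : 1 - 2 * expR (- (eps / 2 * L)) <= (1 - 2 * tau) ^+ n.
  apply: le_trans (bernoulli_le n (x := 2 * tau) _); last by apply/andP; split; lra.
  by rewrite -ntau; lra.
have rn1 : (1 - 2 * tau) ^+ n <= 1 by rewrite exprn_ile1//; lra.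
have Np : n%:R ^+ 6 <= N%:R * p.
  apply: (@le_trans _ _ (expR ((1 + eps) * kappa * L) * p)); last first.
    by rewrite ler_wpM2r//; case/andP: p01.
  have -> : p = expR ((- (1 + eps / 2) * L - ln 64) * (beta + n%:R / 2 + 2)).
    by rewrite expRM expRD expRN lnK// posrE.
  rewrite -[in leLHS]expL -expRM_natl -expRD ler_expR kappaE.
  have := eps_kappa_L; set K := kappa => eKL.
  have K0 : 0 <= K + 3 / 2 by rewrite /K -natr1; have := beta_gt; have := ltW nR0; lra.
  have : ln 64 * (K + 3 / 2) <= eps / 4 * L * (K + 3 / 2) by rewrite ler_wpM2r.
  lra.
have card : ((2 * n ^ 3).+1 ^ n)%:R <= expR (2 * n%:R ^+ 4) :> R.
  rewrite natrX (_ : 2 * n%:R ^+ 4 = n%:R * (2 * n ^ 3)%:R); last first.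
    by rewrite natrM natrX; ring.
  rewrite expRM_natl lerXn2r ?nnegrE ?expR_ge0//.
  by rewrite -natr1 addrC; exact: expR_ge1Dx.
have miss : ((2 * n ^ 3).+1 ^ n)%:R * (1 - p) ^+ N <= expR (- L).
  case/andP: p01 => p0 p1.
  apply: (@le_trans _ _ (expR (2 * n%:R ^+ 4) * expR (- p) ^+ N)).
    rewrite ler_pM ?exprn_ge0 ?subr_ge0// lerXn2r ?nnegrE ?expR_ge0 ?subr_ge0//.
    exact: expR_ge1Dx.
  rewrite -expRM_natl -expRD ler_expR.
  have : 1 + L <= n%:R by rewrite -[leRHS]expL; exact: expR_ge1Dx.
  move: Np n2; set x : R := n%:R => Np x2 Lx.
  have x22 : 4 <= x ^+ 2 by nra.
  have x4 : 0 <= x ^+ 4 by rewrite exprn_ge0//; lra.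
  have x6 : 4 * x ^+ 4 <= x ^+ 6.
    by rewrite (_ : x ^+ 6 = x ^+ 2 * x ^+ 4) ?ler_wpM2r//; ring.
  have x42 : x <= x ^+ 4 by rewrite ler_eXnr//; lra.
  lra.
have e2 : expR (- (eps / 2 * L)) <= expR (- (eps / 4 * L)) by rewrite ler_expR; lra.
have e4 : expR (- L) <= expR (- (eps / 4 * L)) by rewrite ler_expR; lra.
move: miss rn rn1; set m := _ * (1 - p) ^+ N; set rr := (1 - 2 * tau) ^+ n => miss rn rn1.
have m0 : 0 <= m by rewrite mulr_ge0// exprn_ge0// subr_ge0; case/andP: p01.
have : 0 <= m * (1 - rr) by rewrite mulr_ge0// subr_ge0.
lra.
Qed.

End asymptotics.

Lemma near_large_n (R : realType) (A B : R) :
  \forall n \near \oo, [/\ A <= n%:R :> R, B <= ln n%:R :> R & (1 < n)%N].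
Proof.
near=> n.
have nB : expR B <= n%:R :> R by near: n; exact: nbhs_infty_ger.
split; first by near: n; exact: nbhs_infty_ger.
  by rewrite -[leLHS]expRK ler_ln ?posrE ?expR_gt0// (lt_le_trans _ nB) ?expR_gt0.
by near: n; exists 2%N.
Unshelve. all: by end_near. Qed.

Lemma cvg_error (R : realType) (eps : R) : 0 < eps ->
  3 * expR (- (eps / 4 * ln n%:R)) @[n --> \oo] --> (0 : R).
Proof.
move=> e0; apply/cvgr0Pnorm_le => e ee; near=> n.
have [_ h _] : [/\ 0 <= n%:R :> R, - ln (e / 3) * (4 / eps) <= ln n%:R :> R & (1 < n)%N].
  by near: n; exact: near_large_n.
rewrite ger0_norm ?mulr_ge0 ?expR_ge0//.
have e3 : 0 < e / 3 by rewrite divr_gt0.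
rewrite mulrC -ler_pdivlMr// -[leRHS]lnK ?posrE// ler_expR.
have : - ln (e / 3) <= eps / 4 * ln n%:R.
  rewrite -ler_pdivrMl ?divr_gt0//; apply: le_trans h.
  by rewrite mulrC invf_div.
lra.
Unshelve. all: by end_near. Qed.

Theorem theorem1p1 (R : realType) (eps : R) (beta : nat -> R) (N : nat -> nat)
    (d : nat -> measure_display) (Omega : forall n, measurableType (d n))
    (P : forall n, probability (Omega n) R)
    (X : forall n, 'I_(N n) -> {RV (P n) >-> n.-tuple R}) :
  0 < eps < 1 ->
  (forall n, -1 < beta n) ->
  (forall n, (n < N n)%N) ->
  (forall n, independent_points (X n)) ->
  (forall n, beta_distributed (X n) (beta n)) ->
  ((\forall n \near \oo, (N n)%:R <=
      expR ((1 - eps) * (beta n + n.+1%:R / 2) * ln n%:R)) ->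
    (expected_volume (X n) / vol n (unit_ball n))%E @[n --> \oo] --> 0%E) /\
  ((\forall n \near \oo,
      expR ((1 + eps) * (beta n + n.+1%:R / 2) * ln n%:R) <= (N n)%:R) ->
    (expected_volume (X n) / vol n (unit_ball n))%E @[n --> \oo] --> 1%E).
Proof.
move=> eps01 beta1 nN indX distX; have e0 : 0 < eps by case/andP: eps01.
have N0 n : (0 < N n)%N by exact: leq_ltn_trans (nN n).
pose err (n : nat) : R := 3 * expR (- (eps / 4 * ln n%:R)).
have err0 : err n @[n --> \oo] --> (0 : R) := cvg_error e0.
have large : \forall n \near \oo, [/\ 73 <= eps * n%:R, ln 64 <= eps / 4 * ln n%:R & (1 < n)%N].
  near=> n; have [h1 h2 h3] : [/\ 73 / eps <= n%:R :> R,
      ln 64 * (4 / eps) <= ln n%:R :> R & (1 < n)%N].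
    by near: n; exact: near_large_n.
  split => //; first by rewrite mulrC -ler_pdivrMr.
  by rewrite -ler_pdivrMl ?divr_gt0//; apply: le_trans h2; rewrite mulrC invf_div.
split=> hN.
- apply: (@squeeze_cvge _ _ _ _ (cst 0%E) _ (fun n => (err n)%:E)); last 2 first.
  + exact: cvg_cst.
  + by apply: cvg_EFin => //; near=> n.
  near=> n; rewrite ratio_ge0 /=.
  have [h1 h2 h3] : [/\ 73 <= eps * n%:R, ln 64 <= eps / 4 * ln n%:R & (1 < n)%N].
    by near: n.
  apply: (ratio_small h3 (N0 n) (@distX n) (beta1 n) eps01 h1).
  by near: n.
- apply: (@squeeze_cvge _ _ _ _ (fun n => (1 - err n)%:E) _ (cst 1%E)); last 2 first.
  + apply: cvg_EFin; first by near=> n.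
    rewrite -[X in _ --> X]subr0; apply: cvgB => //; exact: cvg_cst.
  + exact: cvg_cst.
  near=> n; rewrite (ratio_le1 (N0 n) (@distX n)) andbT.
  have [h1 h2 h3] : [/\ 73 <= eps * n%:R, ln 64 <= eps / 4 * ln n%:R & (1 < n)%N].
    by near: n.
  apply: (ratio_big h3 (N0 n) (@indX n) (@distX n) (beta1 n) eps01 h1 h2).
  by near: n.
Unshelve. all: by end_near. Qed.
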